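(* Let $g\in L^2(\mathbb{R})$ and $\Lambda\subset\mathbb{R}^2$. If $G(g,\Lambda)$ is uniformly minimal in $L^2(\mathbb{R})$, then \[ D^+(\Lambda):=\limsup_{R\to\infty}\frac{\sup_{(a,b)\in\mathbb{R}^2}|\Lambda\cap Q_{(a,b)}(R)|}{(2R)^2}\le 1. \]
   Context: For $g\in L^2(\mathbb{R})$ and $(a,b)\in\mathbb{R}^2$ put $g_{ab}(t)=e^{2\pi i b t}g(t-a)$. The Gabor system is $G(g,\Lambda)=\{g_{\lambda\mu}\}_{(\lambda,\mu)\in\Lambda}$. $Q_{(a,b)}(R)=\{(x,y):|x-a|\le R,\ |y-b|\le R\}$, and $|\Lambda\cap S|$ is the number of points of $\Lambda$ in $S$. A system $\{f_n\}$ in a Hilbert space is uniformly minimal if there is $\delta>0$ such that $\operatorname{dist}(f_n,\overline{\operatorname{span}}\{f_k\}_{k\ne n})>\delta$ for all $n$. *)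

(* Defs.v *)
From HB Require Import structures.
From mathcomp Require Import all_boot all_order all_algebra.
From mathcomp Require Import all_classical all_reals all_analysis.
From mathcomp Require Import complex.
Set Implicit Arguments. Unset Strict Implicit. Unset Printing Implicit Defensive.
Import Order.TTheory GRing.Theory Num.Theory.
Import numFieldTopology.Exports.
Local Open Scope classical_set_scope.
Local Open Scope ring_scope.

Section GaborDefs.
Variable R : realType.

Definition csq (z : R[i]) : R := (complex.Re z) ^+ 2 + (complex.Im z) ^+ 2.

Definition L2fun (f : R -> R[i]) : Prop :=
  measurable_fun setT (fun t => complex.Re (f t)) /\
  measurable_fun setT (fun t => complex.Im (f t)) /\
  (\int[lebesgue_measure]_(t in setT) (csq (f t))%:E < +oo)%E.

Definition L2norm (f : R -> R[i]) : \bar R :=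
  ((\int[lebesgue_measure]_(t in setT) (csq (f t))%:E) `^ (2^-1))%E.

Definition cexp2pi (x : R) : R[i] :=
  Complex (cos (2 * pi * x)) (sin (2 * pi * x)).

Definition tfshift (g : R -> R[i]) (ab : R * R) : R -> R[i] :=
  fun t => cexp2pi (ab.2 * t) * g (t - ab.1).

Definition span_others (g : R -> R[i]) (Lambda : set (R * R)) (lam : R * R)
    : set (R -> R[i]) :=
  [set h | exists s : seq ((R * R) * R[i]),
      (forall p, p \in s -> Lambda p.1 /\ p.1 <> lam) /\
      h = (fun t => \sum_(p <- s) p.2 * tfshift g p.1 t)].

(* distance in L^2 from f to a set S of functions; the distance to the
   closure of S equals the distance to S *)
Definition L2dist (f : R -> R[i]) (S : set (R -> R[i])) : \bar R :=
  ereal_inf [set L2norm (fun t => f t - h t) | h in S].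

Definition gabor_uniformly_minimal (g : R -> R[i]) (Lambda : set (R * R)) : Prop :=
  exists delta : R, 0 < delta /\
    forall lam, Lambda lam ->
      (delta%:E < L2dist (tfshift g lam) (span_others g Lambda lam))%E.

Definition Qsq (ab : R * R) (r : R) : set (R * R) :=
  [set xy | `|xy.1 - ab.1| <= r /\ `|xy.2 - ab.2| <= r].

Definition npoints (Lambda : set (R * R)) (S : set (R * R)) : \bar R :=
  (\esum_(x in Lambda `&` S) 1)%E.

Definition upper_density (Lambda : set (R * R)) : \bar R :=
  limf_esup
    (fun r : R => (ereal_sup [set npoints Lambda (Qsq ab r) | ab in [set: R * R]]
                   * ((2 * r) ^+ 2)^-1%:E)%E)
    (pinfty_nbhs R).

End GaborDefs.

(* Main.v *)
(* The functions e^(2 pi i n t) 1_[m,m+1), (m,n) integers, span L^2; hence, uniformly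
   in (a,b), the shift g_(ab) is within eps of the span of those with
   |m - a|, |n - b| <= r(eps).  Approximating g by a continuous function of compact
   support and sampling it on a fine grid reduces this to indicators of small
   intervals, which are L^2 limits of trigonometric polynomials.  So all g_lambda with
   lambda in a square of side 2R lie within eps of one space W of dimension at most
   (2R + 2r + 2)^2.  If N of them are delta-separated from the span of the others, then
   comparing the trace of the projections onto W and onto the span of the g_lambda with
   dim W gives N (1 - eps / delta) <= dim W. *)
Require Import Defs.
From HB Require Import structures.
From mathcomp Require Import all_boot all_order all_algebra.
From mathcomp Require Import all_classical all_reals all_analysis.
From mathcomp Require Import complex.
From mathcomp Require Import measurable_realfun ring lra.
Set Implicit Arguments. Unset Strict Implicit. Unset Printing Implicit Defensive.
Import Order.TTheory GRing.Theory Num.Theory.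
Import numFieldNormedType.Exports.
Local Open Scope classical_set_scope.
Local Open Scope ring_scope.

(** Uniformity in (a,b) is the obstacle. Time-frequency shifts preserve the norm and compose up to a
    unimodular scalar, and integer shifts permute the generators up to such scalars, so (a,b) may be
    taken in [0,1)^2. There one grid serves all shifts of a function of compact support, and the
    approximations of its cells are fixed before (a,b): only the sampled coefficients depend on the
    shift. Errors are squared norms, added with |z + w|^2 <= 2|z|^2 + 2|w|^2; this is the origin of
    the bounds [e / 4]. Elements of L^2 are functions here, not classes, so the inner product is
    only semi-definite and the linear algebra holds modulo vectors of norm zero. It is done over the
    reals, with the real part of the Hermitian product. Separation enters only through the bound on
    the dual system, so eps is a fixed fraction of delta, chosen before R. Then r is fixed as well,
    and the margin 2r + 2 disappears in the ratio as R grows. *)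

Section Span.
Variables (K : nzRingType) (V : lmodType K).

(** The scalars are arbitrary, as complex spans and the real spans of the dimension count both
    occur. *)
Inductive span (A : set V) : set V :=
| span0 : span A 0
| span_cons c x y : A x -> span A y -> span A (c *: x + y).

Lemma span_gen (A : set V) x : A x -> span A x.
Proof. by move=> Ax; rewrite -(addr0 x) -(scale1r x); apply: span_cons => //; exact: span0. Qed.

Lemma spanD (A : set V) x y : span A x -> span A y -> span A (x + y).
Proof.
move=> sx sy; elim: sx => [|c z t Az _ IH]; first by rewrite add0r.
by rewrite -addrA; exact: span_cons.
Qed.

Lemma spanZ (A : set V) c x : span A x -> span A (c *: x).
Proof.
elim=> [|d z t Az _ IH]; first by rewrite scaler0; exact: span0.
by rewrite scalerDr scalerA; exact: span_cons.
Qed.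

Lemma spanB (A : set V) x y : span A x -> span A y -> span A (x - y).
Proof. by move=> sx sy; rewrite -scaleN1r; apply: spanD => //; exact: spanZ. Qed.

Lemma span_sum (A : set V) (I : Type) (r : seq I) (P : pred I) (F : I -> V) :
  (forall i, P i -> span A (F i)) -> span A (\sum_(i <- r | P i) F i).
Proof. by move=> sF; elim/big_ind: _ => //; [exact: span0 | exact: spanD]. Qed.

Lemma span_sub (A B : set V) : A `<=` span B -> span A `<=` span B.
Proof.
move=> AB x; elim=> [|c z t Az _ IH]; first exact: span0.
by apply: spanD => //; apply: spanZ; exact: AB.
Qed.

Lemma span_mono (A B : set V) : A `<=` B -> span A `<=` span B.
Proof. by move=> AB; apply: span_sub => x Ax; apply: span_gen; exact: AB. Qed.

End Span.

(** * Linear algebra of a positive semi-definite real inner product *)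

Section InnerProduct.
Variables (R : realType) (V : lmodType R) (ip : V -> V -> R).
Hypothesis ipC : forall x y, ip x y = ip y x.
Hypothesis ipDl : forall x y z, ip (x + y) z = ip x z + ip y z.
Hypothesis ipZl : forall a x y, ip (a *: x) y = a * ip x y.
Hypothesis ip_ge0 : forall x, 0 <= ip x x.

Let ipDr x y z : ip z (x + y) = ip z x + ip z y.
Proof. by rewrite ipC ipDl !(ipC z). Qed.
Let ipZr a x y : ip y (a *: x) = a * ip y x.
Proof. by rewrite ipC ipZl (ipC y). Qed.
Let ipBl x y z : ip (x - y) z = ip x z - ip y z.
Proof. by rewrite ipDl -scaleN1r ipZl mulN1r. Qed.
Let ipBr x y z : ip z (x - y) = ip z x - ip z y.
Proof. by rewrite ipC ipBl !(ipC z). Qed.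
Let ip0l x : ip 0 x = 0.
Proof. by rewrite -(scale0r x) ipZl mul0r. Qed.
Let ip0r x : ip x 0 = 0.
Proof. by rewrite ipC ip0l. Qed.
Let ip_suml (I : Type) (r : seq I) (P : pred I) (F : I -> V) y :
  ip (\sum_(i <- r | P i) F i) y = \sum_(i <- r | P i) ip (F i) y.
Proof. by elim/big_rec2: _ => [|i a b _ <-]; [exact: ip0l | exact: ipDl]. Qed.

Lemma ip_CS x y : ip x y ^+ 2 <= ip x x * ip y y.
Proof.
have H t : 0 <= ip x x + 2 * t * ip x y + t ^+ 2 * ip y y.
  have := ip_ge0 (x + t *: y); rewrite ipDl !ipDr !ipZl !ipZr (ipC y x) => h.
  by move: h; congr (0 <= _); ring.
have [y0|y0] := eqVneq (ip y y) 0.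
  have [->|xy0] := eqVneq (ip x y) 0; first by rewrite y0; lra.
  (* With [ip y y = 0] the quadratic is affine in [t]; at this [t] its value is -1. *)
  have := H (- (ip x x + 1) / (2 * ip x y)); rewrite y0 mulr0 addr0.
  rewrite (_ : 2 * _ * _ = - (ip x x + 1)); last by field.
  by lra.
have yp : 0 < ip y y by rewrite lt_def y0 ip_ge0.
have := H (- ip x y / ip y y).
rewrite (_ : _ + _ + _ = (ip x x * ip y y - ip x y ^+ 2) / ip y y); last by field.
by rewrite pmulr_lge0 ?invr_gt0// subr_ge0.
Qed.

(** Substitute for definiteness: a null vector need not be zero, but Cauchy-Schwarz makes it
    orthogonal to everything. *)
Lemma ip_null x y : ip x x = 0 -> ip x y = 0.
Proof.
move=> x0; have := ip_CS x y; rewrite x0 mul0r => h.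
by apply/eqP; rewrite -sqrf_eq0 eq_le h sqr_ge0.
Qed.

Lemma ip_span_eq0 (A : set V) x w :
  (forall v, A v -> ip x v = 0) -> span A w -> ip x w = 0.
Proof.
move=> xA; elim=> [|c z t Az _ IH]; first exact: ip0r.
by rewrite ipDr ipZr xA// mulr0 add0r.
Qed.

Fixpoint orthonormal (e : seq V) : Prop :=
  if e is u :: e' then [/\ ip u u = 1, forall v, v \in e' -> ip u v = 0 & orthonormal e']
  else True.

Definition proj (e : seq V) (x : V) : V := \sum_(u <- e) ip x u *: u.

Lemma ip_proj e x v : orthonormal e -> v \in e -> ip (proj e x) v = ip x v.
Proof.
elim: e => // u e IH [uu ue oe]; rewrite /proj big_cons ipDl ipZl inE.
have [-> _|vu /= ve] := eqVneq v u.
  rewrite uu mulr1 ip_suml big1_seq ?addr0// => w /= we.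
  by rewrite ipZl (ipC w) ue// mulr0.
by rewrite ue// mulr0 add0r; exact: IH.
Qed.

Lemma orthonormal_norm e u : orthonormal e -> u \in e -> ip u u = 1.
Proof.
by elim: e => // w e IH [ww we oe]; rewrite inE => /predU1P[->//|]; exact: IH.
Qed.

(** A remainder of norm zero is dropped instead of normalised. Hence [e] may be shorter than [s],
    and each [x] equals its projection only up to a null vector. *)
Lemma gram_schmidt (s : seq V) : exists e : seq V,
  [/\ (size e <= size s)%N, orthonormal e,
      forall u, u \in e -> span [set` s] u
    & forall x, x \in s -> forall y, ip (x - proj e x) y = 0].
Proof.
elim: s => [|x s [e [se oe es ex]]]; first by exists [::].
have es' u : u \in e -> span [set` x :: s] u.
  by move=> /es; apply: span_mono => z /= zs; rewrite inE zs orbT.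
have sxx : span [set` x :: s] x by apply: span_gen; rewrite /= inE eqxx.
pose r := x - proj e x.
have spr : span [set` x :: s] r.
  apply: spanB => //; rewrite /proj big_seq; apply: span_sum => u ue.
  by apply: spanZ; exact: es'.
have re v : v \in e -> ip r v = 0 by move=> ve; rewrite ipBl ip_proj// subrr.
have [r0|r0] := eqVneq (ip r r) 0.
  exists e; split => //; first exact: leqW.
  move=> z; rewrite inE => /predU1P[-> y|]; last exact: ex.
  exact: ip_null.
pose c := Num.sqrt (ip r r).
have c2 : c ^+ 2 = ip r r by rewrite sqr_sqrtr.
have c0 : c != 0 by apply: contra_neq r0 => c0; rewrite -c2 c0 expr0n.
pose u := c^-1 *: r.
have ue v : v \in e -> ip u v = 0 by move=> ve; rewrite ipZl re// mulr0.
have uproj z : ip (proj e z) u = 0.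
  by rewrite ip_suml big1_seq// => v /= ve; rewrite ipZl (ipC v) ue// mulr0.
exists (u :: e); split => //.
- by split => //; rewrite ipZl ipZr -c2; field.
- by move=> v; rewrite inE => /predU1P[->|/es'//]; exact: spanZ.
move=> z zs y; rewrite /proj big_cons -/(proj e z) opprD addrCA ipDl.
move: zs; rewrite inE => /predU1P[->|zs].
  rewrite -/r -scaleNr ipZl /u ipZl ipZr.
  have -> : ip x r = ip r r.
    rewrite -[x in LHS](subrK (proj e x)) -/r ipDl.
    have : ip (proj e x) u = 0 by [].
    rewrite /u ipZr => /eqP; rewrite mulf_eq0 invr_eq0 (negbTE c0)/= => /eqP ->.
    by rewrite addr0.
  by rewrite -c2; field.
rewrite ex// addr0.
have -> : ip z u = 0.
  by rewrite -[z](subrK (proj e z)) ipDl ex// uproj addr0.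
by rewrite scale0r oppr0 ip0l.
Qed.

(** Orthogonality to [e] passes to the span of [s] because each member of [s] differs from a
    combination of [e] by a null vector. *)
Lemma orthogonal_projection (s : seq V) : exists e : seq V,
  [/\ (size e <= size s)%N, orthonormal e,
      forall x, span [set` s] (proj e x)
    & forall x w, span [set` s] w -> ip (x - proj e x) w = 0].
Proof.
have [e [se oe es ex]] := gram_schmidt s; exists e; split => // x.
  by rewrite /proj big_seq; apply: span_sum => u ue; apply: spanZ; exact: es.
move=> w sw; apply: ip_span_eq0 sw => v /= vs.
rewrite -[v](subrK (proj e v)) ipDr [X in X + _]ipC [X in X + _]ex// add0r.
rewrite ipC ip_suml big1_seq// => u /= ue.
by rewrite ipZl (ipC u) ipBl ip_proj// subrr mulr0.
Qed.

(** Pythagoras: [x - proj e x] is orthogonal to [proj e x - w], which lies in the span. *)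
Lemma proj_nearest (s e : seq V) x w : span [set` s] (proj e x) ->
  (forall w, span [set` s] w -> ip (x - proj e x) w = 0) -> span [set` s] w ->
  ip (x - proj e x) (x - proj e x) <= ip (x - w) (x - w).
Proof.
move=> se ex sw; have spw := spanB se sw.
rewrite -(subrKA (proj e x) x (- w)); move: (ex _ spw) (ip_ge0 (proj e x - w)).
move: (x - proj e x) (proj e x - w) => p q pq0 q0.
by rewrite ipDl !ipDr (ipC q p) pq0; lra.
Qed.

(* The dual system [h] of [f] satisfies [|h i| <= 1 / delta].  With [P], [Q] the
   orthogonal projections onto the spans of [ws] and [f], the trace
   [\sum_i <P (f i), h i>] of [Q P] is at most the rank of [P], whereas each of
   its terms is at least [1 - eps / delta]. *)
Lemma card_le_approx_dim (I : finType) (f : I -> V) (ws : seq V) (delta eps : R) :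
  0 < delta -> 0 <= eps ->
  (forall i u, span [set f j | j in [set j | j != i]] u ->
    delta ^+ 2 <= ip (f i - u) (f i - u)) ->
  (forall i, exists2 u, span [set` ws] u & ip (f i - u) (f i - u) <= eps ^+ 2) ->
  #|I|%:R * (1 - eps / delta) <= (size ws)%:R.
Proof.
move=> d0 e0 fd fe.
(* [h i] is the part [r] of [f i] orthogonal to the other [f j], divided by its squared norm, which
   is at least [delta ^+ 2]. *)
have /choice[h hP] : forall i, exists h,
    [/\ ip (f i) h = 1, forall j, j != i -> ip (f j) h = 0,
        ip h h <= (delta ^+ 2)^-1 & span (range f) h].
  move=> i.
  pose s := [seq f j | j <- enum I & j != i].
  have sE : span [set` s] `<=` span [set f j | j in [set j | j != i]].
    by apply: span_mono => y /= /mapP[j]; rewrite mem_filter => /andP[ji _] ->; exists j.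
  have [e [_ _ ep ex]] := orthogonal_projection s.
  set r := f i - proj e (f i).
  have rr : delta ^+ 2 <= ip r r by apply: fd; apply: sE; exact: ep.
  have r0 : 0 < ip r r by apply: lt_le_trans rr; rewrite exprn_gt0.
  exists ((ip r r)^-1 *: r); split.
  - have -> : f i = r + proj e (f i) by rewrite subrK.
    have pr : ip (proj e (f i)) r = 0 by rewrite ipC; exact: ex.
    by rewrite ipZr ipDl pr addr0 mulVf ?gt_eqF.
  - move=> j ji; rewrite ipZr (ipC (f j)) [ip r (f j)]ex ?mulr0//; apply: span_gen => /=.
    by apply/map_f; rewrite mem_filter ji mem_enum.
  - rewrite ipZl ipZr mulVf ?gt_eqF// mulr1 lef_pV2// ?posrE//.
    by rewrite exprn_gt0.
  - apply: spanZ; apply: spanB; first by apply: span_gen; exists i.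
    by have /sE := ep (f i); apply: span_mono => _ [j _ <-]; exists j.
have [e [sze oe ep ex]] := orthogonal_projection ws.
(* Since [ip (f i) (h i) = 1], the defect is the product of [f i - proj e (f i)] with [h i];
   Cauchy-Schwarz applies. *)
have trace_ge i : 1 - eps / delta <= ip (proj e (f i)) (h i).
  have [fh _ hh _] := hP i.
  rewrite -[proj _ _](subKr (f i)) ipBl fh lerD2l lerN2.
  have [u su ue] := fe i.
  have := proj_nearest (ep _) (ex (f i)) su.
  have := ip_CS (f i - proj e (f i)) (h i); set p := f i - _ => CS pu.
  apply: le_trans (ler_norm _) _.
  rewrite -(@ler_pXn2r _ 2)// ?nnegrE ?divr_ge0 ?(ltW d0)// real_normK ?num_real//.
  apply: le_trans CS _; rewrite expr_div_n; apply: ler_pM => //.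
  exact: le_trans pu _.
(* [f j] and its expansion in the dual system differ by a vector that lies in the span of [f] and is
   orthogonal to it, hence is null. *)
have span_f_null j y : (forall i, ip y (h i) = 0) -> ip (f j) y = 0.
  move=> yh; pose d := f j - \sum_i ip (f j) (f i) *: h i.
  have df l : ip d (f l) = 0.
    rewrite ipBl ip_suml (bigD1 l)//= big1 => [|i il].
      by rewrite ipZl (ipC (h l)); case: (hP l) => -> _ _ _; rewrite mulr1 addr0 subrr.
    by rewrite ipZl (ipC (h i)); case: (hP i) => _ -> //; rewrite ?mulr0 // eq_sym.
  have dd : ip d d = 0.
    apply: (@ip_span_eq0 (range f)); first by move=> _ [l _ <-].
    apply: spanB; first by apply: span_gen; exists j.
    by apply: span_sum => i _; apply: spanZ; case: (hP i).
  have := ip_null y dd; rewrite ipBl ip_suml big1 ?subr0// => i _.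
  by rewrite ipZl (ipC (h i)) yh mulr0.
have trace_le u : u \in e -> \sum_i ip (f i) u * ip u (h i) <= 1.
  (* [y] is the orthogonal projection of [u] onto the span of [f], so the sum is the squared norm of
     [y], at most that of [u], which is 1. *)
  move=> ue; pose y := \sum_i ip u (h i) *: f i.
  have -> : \sum_i ip (f i) u * ip u (h i) = ip y u.
    by rewrite ip_suml; apply: eq_bigr => i _; rewrite ipZl mulrC.
  have uyh i : ip (u - y) (h i) = 0.
    rewrite ipBl ip_suml (bigD1 i)//= big1 => [|l li].
      by rewrite ipZl; case: (hP i) => -> _ _ _; rewrite mulr1 addr0 subrr.
    by rewrite ipZl; case: (hP i) => _ -> //; rewrite mulr0.
  have : ip y (u - y) = 0.
    by rewrite ip_suml big1// => i _; rewrite ipZl span_f_null ?mulr0.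
  have := ip_ge0 (u - y); rewrite ipBl !ipBr (orthonormal_norm oe ue) (ipC u y).
  by lra.
rewrite mulrC mulr_natr -sumr_const.
apply: (@le_trans _ _ (\sum_i ip (proj e (f i)) (h i))).
  by rewrite ler_sum.
apply: (@le_trans _ _ (\sum_(u <- e) \sum_i ip (f i) u * ip u (h i))).
  rewrite exchange_big/= le_eqVlt; apply/orP; left; apply/eqP.
  by apply: eq_bigr => i _; rewrite ip_suml; apply: eq_bigr => u _; rewrite ipZl.
apply: (@le_trans _ _ (\sum_(u <- e) 1)).
  by rewrite !big_seq; apply: ler_sum => u ue; exact: trace_le.
by rewrite big_const_seq count_predT iter_addr_0 ler_nat.
Qed.

End InnerProduct.

(** * Squared norms of complex functions on the line *)

Section L2.
Variable R : realType.
Implicit Types (f g h : R -> R[i]) (z w : R[i]).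
Local Notation mu := (@lebesgue_measure R).
Local Notation re := complex.Re.
Local Notation im := complex.Im.

Lemma csq_ge0 z : 0 <= csq z.
Proof. by rewrite addr_ge0// sqr_ge0. Qed.

Lemma csq0 : csq (0 : R[i]) = 0.
Proof. by rewrite /csq/= expr0n/= addr0. Qed.

Lemma csqM z w : csq (z * w) = csq z * csq w.
Proof. by case: z w => [a b] [c d]; rewrite /csq/=; ring. Qed.

Lemma csqD_le z w : csq (z + w) <= 2 * csq z + 2 * csq w.
Proof.
case: z w => [a b] [c d]; rewrite /csq/=.
by have := sqr_ge0 (a - c); have := sqr_ge0 (b - d); nra.
Qed.

Lemma csq_real (x : R) : csq x%:C%C = x ^+ 2.
Proof. by rewrite /csq/= expr0n/= addr0. Qed.

Lemma csq_cexp2pi (x : R) : csq (cexp2pi x) = 1.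
Proof. by rewrite /csq/= cos2Dsin2. Qed.

Lemma cexp2piD (x y : R) : cexp2pi (x + y) = cexp2pi x * cexp2pi y.
Proof.
by rewrite /cexp2pi mulrDr cosD sinD; congr (_ +i* _)%C; rewrite // addrC.
Qed.

Lemma cexp2pi0 : cexp2pi (0 : R) = 1.
Proof. by rewrite /cexp2pi mulr0 cos0 sin0. Qed.

Lemma cexp2piK (x : R) : cexp2pi (- x) * cexp2pi x = 1.
Proof. by rewrite -cexp2piD addNr cexp2pi0. Qed.

Definition cmeasurable f :=
  measurable_fun setT (fun t => re (f t)) /\ measurable_fun setT (fun t => im (f t)).

Lemma cmeasurable_cst z : cmeasurable (cst z).
Proof. by split; exact: measurable_cst. Qed.

Lemma cmeasurableD f g : cmeasurable f -> cmeasurable g -> cmeasurable (f + g).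
Proof.
move=> [rf jf] [rg jg]; split.
  rewrite (_ : (fun _ => _) = (fun t => re (f t)) \+ (fun t => re (g t))).
    exact: measurable_funD.
  by apply/funext => t /=; rewrite fctE; case: (f t) (g t) => ? ? [].
rewrite (_ : (fun _ => _) = (fun t => im (f t)) \+ (fun t => im (g t))).
  exact: measurable_funD.
by apply/funext => t /=; rewrite fctE; case: (f t) (g t) => ? ? [].
Qed.

Lemma cmeasurableM f g : cmeasurable f -> cmeasurable g -> cmeasurable (f * g).
Proof.
move=> [rf jf] [rg jg]; split.
  rewrite (_ : (fun _ => _) = ((fun t => re (f t)) \* (fun t => re (g t))) \-
    ((fun t => im (f t)) \* (fun t => im (g t)))).
    by apply: measurable_funB; exact: measurable_funM.
  by apply/funext => t /=; rewrite fctE; case: (f t) (g t) => ? ? [].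
rewrite (_ : (fun _ => _) = ((fun t => re (f t)) \* (fun t => im (g t))) \+
    ((fun t => im (f t)) \* (fun t => re (g t)))).
  by apply: measurable_funD; exact: measurable_funM.
by apply/funext => t /=; rewrite fctE; case: (f t) (g t) => ? ? [].
Qed.

Lemma cmeasurableZ z f : cmeasurable f -> cmeasurable (z *: f).
Proof. by move=> mf; exact: (cmeasurableM (cmeasurable_cst z) mf). Qed.

Lemma cmeasurableB f g : cmeasurable f -> cmeasurable g -> cmeasurable (f - g).
Proof.
by move=> mf mg; apply: cmeasurableD => //; rewrite -scaleN1r; exact: cmeasurableZ.
Qed.

Lemma cmeasurable_real (p : R -> R) :
  measurable_fun setT p -> cmeasurable (fun t => (p t)%:C%C).
Proof. by move=> mp; split => //; exact: measurable_cst. Qed.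

Lemma cmeasurable_cexp2pi (b : R) : cmeasurable (fun t => cexp2pi (b * t)).
Proof.
split => /=; apply: continuous_measurable_fun => t.
  apply: continuous_comp; last exact: continuous_cos.
  by do 2 (apply: cvgM; first exact: cvg_cst); exact: cvg_id.
apply: continuous_comp; last exact: continuous_sin.
by do 2 (apply: cvgM; first exact: cvg_cst); exact: cvg_id.
Qed.

Lemma measurable_shift (a : R) : measurable_fun setT (fun t : R => t - a).
Proof. by apply: measurable_funB => //; exact: measurable_cst. Qed.

Lemma cmeasurable_tfshift f ab : cmeasurable f -> cmeasurable (tfshift f ab).
Proof.
move=> [rf jf]; apply: (cmeasurableM (cmeasurable_cexp2pi _)).
by split; [apply: (measurableT_comp rf) | apply: (measurableT_comp jf)];
  exact: measurable_shift.
Qed.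

Lemma measurable_csq f : cmeasurable f -> measurable_fun setT (fun t => csq (f t)).
Proof. by move=> [rf jf]; apply: measurable_funD; apply: measurable_funX. Qed.

Lemma measurable_ecsq f : cmeasurable f -> measurable_fun setT (fun t => (csq (f t))%:E).
Proof. by move=> mf; apply/measurable_EFinP; exact: measurable_csq. Qed.

(** Squared norm in the extended reals: estimates need measurability only, not finiteness. *)
Definition energy f : \bar R := (\int[mu]_t (csq (f t))%:E)%E.

Lemma energy_ge0 f : (0 <= energy f)%E.
Proof. by apply: integral_ge0 => t _; rewrite lee_fin csq_ge0. Qed.

Lemma energy_mono f g : cmeasurable f -> cmeasurable g ->
  (forall t, csq (f t) <= csq (g t)) -> (energy f <= energy g)%E.
Proof.
move=> mf mg fg; apply: ge0_le_integral => //.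
- by move=> t _; rewrite lee_fin csq_ge0.
- exact: measurable_ecsq.
- exact: measurable_ecsq.
- by move=> t _; rewrite lee_fin.
Qed.

Lemma energyD f g : cmeasurable f -> cmeasurable g ->
  (energy (f + g)%R <= 2%:E * energy f + 2%:E * energy g)%E.
Proof.
move=> mf mg; rewrite -!ge0_integralZl//; try by [exact: measurable_ecsq
  | move=> t _; rewrite lee_fin csq_ge0].
rewrite -ge0_integralD//; try by [move=> t _; rewrite -EFinM lee_fin mulr_ge0// csq_ge0
  | apply: measurable_funeM; exact: measurable_ecsq].
apply: ge0_le_integral => //.
- by move=> t _; rewrite lee_fin csq_ge0.
- by apply: (@measurable_ecsq (f + g)); exact: cmeasurableD.
- by apply: emeasurable_funD; apply: measurable_funeM; exact: measurable_ecsq.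
- by move=> t _; rewrite -!EFinM -EFinD lee_fin csqD_le.
Qed.

Lemma energyZ z f : cmeasurable f -> energy (z *: f) = ((csq z)%:E * energy f)%E.
Proof.
move=> mf; rewrite /energy -ge0_integralZl//.
- by apply: eq_integral => t _; rewrite -EFinM -csqM.
- exact: measurable_ecsq.
- by move=> t _; rewrite lee_fin csq_ge0.
- by rewrite lee_fin csq_ge0.
Qed.

(** Lebesgue measure is determined by its values on half-open intervals, and these are unchanged by
    translation. *)
Lemma lebesgue_measure_shift (a : R) (A : set R) : measurable A ->
  pushforward mu (fun t : measurableTypeR R => t - a : measurableTypeR R) A = mu A.
Proof.
move=> mA; apply/esym/lebesgue_measure_unique => //=.
  exact: measurable_shift.
move=> ? _ [[x y]] _ <-.
rewrite /pushforward (_ : _ @^-1` _ = [set` `]x + a, y + a]]).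
  rewrite !lebesgue_measure_itv/= !lte_fin ltrD2r.
  by case: ifP => // _; rewrite -!EFinB; congr (_%:E); ring.
by apply/seteqP; split => t /=; rewrite !in_itv/= ltrBrDr lerBlDr.
Qed.

Lemma energy_translate f a : cmeasurable f -> energy (fun t => f (t - a)) = energy f.
Proof.
move=> mf.
have mshift : measurable_fun setT (fun t : measurableTypeR R => t - a : measurableTypeR R).
  exact: measurable_shift.
transitivity (\int[pushforward mu (fun t : measurableTypeR R => (t - a)%R : measurableTypeR R)]_t
   (csq (f t))%:E)%E.
  rewrite ge0_integral_pushforward//; first exact: measurable_ecsq.
  by move=> t _; rewrite lee_fin csq_ge0.
by apply: eq_measure_integral => A mA _; exact: lebesgue_measure_shift.
Qed.

Lemma energy_tfshift f ab : cmeasurable f -> energy (tfshift f ab) = energy f.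
Proof.
move=> mf; rewrite -(energy_translate ab.1 mf).
by apply: eq_integral => t _; rewrite csqM csq_cexp2pi mul1r.
Qed.

Lemma L2funE f : L2fun f <-> cmeasurable f /\ (energy f < +oo)%E.
Proof. by split=> [[mr [mi E]]|[[mr mi] E]]. Qed.

Lemma L2fun0 : L2fun (0 : R -> R[i]).
Proof.
apply/L2funE; split; first exact: (cmeasurable_cst 0).
by rewrite /energy integral0_eq// => t _; rewrite csq0.
Qed.

Lemma L2funD f g : L2fun f -> L2fun g -> L2fun (f + g).
Proof.
move=> /L2funE[mf Ef] /L2funE[mg Eg]; apply/L2funE; split; first exact: cmeasurableD.
by apply: le_lt_trans (energyD mf mg) _; rewrite lte_add_pinfty// lte_mul_pinfty// energy_ge0.
Qed.

Lemma L2funZ z f : L2fun f -> L2fun (z *: f).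
Proof.
move=> /L2funE[mf Ef]; apply/L2funE; split; first exact: cmeasurableZ.
by rewrite energyZ// lte_mul_pinfty// lee_fin csq_ge0.
Qed.

Lemma L2fun_tfshift f ab : L2fun f -> L2fun (tfshift f ab).
Proof.
move=> /L2funE[mf Ef]; apply/L2funE; split; first exact: cmeasurable_tfshift.
by rewrite energy_tfshift.
Qed.

Lemma L2fun_span (A : set (R -> R[i])) f : A `<=` @L2fun R -> span A f -> L2fun f.
Proof.
move=> AL; elim=> [|c x y Ax _ IH]; first exact: L2fun0.
by apply: L2funD => //; apply: L2funZ; exact: AL.
Qed.

End L2.

(** * Square-integrable functions as a real vector space *)

Section L2Space.
Variable R : realType.
Local Notation mu := (@lebesgue_measure R).
Local Notation re := complex.Re.
Local Notation im := complex.Im.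

(** The codomain [Rcomplex R] gives these functions real scalars, as the dimension count
    requires. *)
Definition L2pred : {pred R -> Rcomplex R} := fun f => `[< L2fun (f : R -> R[i]) >].

Lemma rscaleE (a : R) (f : R -> Rcomplex R) :
  a *: f = (a%:C%C : R[i]) *: (f : R -> R[i]).
Proof.
apply/funext => t; rewrite !fctE; case: (f t) => b c.
by apply/eqP; rewrite eq_complex /= !mul0r subr0 addr0 !eqxx.
Qed.

Lemma L2pred_submod_closed : submod_closed L2pred.
Proof.
split=> [|a f g /asboolP Lf /asboolP Lg]; apply/asboolP; first exact: L2fun0.
by apply: L2funD => //; rewrite rscaleE; exact: L2funZ.
Qed.
HB.instance Definition _ :=
  GRing.isSubmodClosed.Build R (R -> Rcomplex R) L2pred L2pred_submod_closed.

Record L2 := MkL2 { L2val :> R -> Rcomplex R; _ : L2val \in L2pred }.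
HB.instance Definition _ := [isSub for L2val].
HB.instance Definition _ := [Choice of L2 by <:].
HB.instance Definition _ := [SubChoice_isSubLmodule of L2 by <:].

Lemma L2valP (f : L2) : L2fun (f : R -> R[i]).
Proof. by case: f => f /= /asboolP. Qed.

(** Real part of the Hermitian product. It is only semi-definite, since functions equal almost
    everywhere are not identified. *)
Definition L2ip (f g : L2) : R :=
  \int[mu]_t (re (f t) * re (g t) + im (f t) * im (g t)).

Lemma L2ip_integrable (f g : L2) :
  mu.-integrable setT (EFin \o (fun t => re (f t) * re (g t) + im (f t) * im (g t))).
Proof.
have /L2funE[[mrf mif] Ef] := L2valP f; have /L2funE[[mrg mig] Eg] := L2valP g.
have If (h : L2) : mu.-integrable setT (fun t => (csq (h t))%:E).
  have /L2funE[mh Eh] := L2valP h; apply/integrableP; split; first exact: measurable_ecsq.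
  by under eq_integral do rewrite gee0_abs ?lee_fin ?csq_ge0//.
have Ifg := integrableD measurableT (If f) (If g).
(* Pointwise, the integrand is at most the sum of the two squared moduli in absolute value. *)
apply: le_integrable Ifg => //.
  apply/measurable_EFinP; apply: measurable_funD; exact: measurable_funM.
move=> t _ /=; rewrite lee_fin [leRHS]ger0_norm; last by apply: addr_ge0; exact: csq_ge0.
rewrite /csq.
move: (re _) (re _) (im _) (im _) => a b c d.
have := sqr_ge0 (a - b); have := sqr_ge0 (a + b).
have := sqr_ge0 (c - d); have := sqr_ge0 (c + d).
have := sqr_ge0 a; have := sqr_ge0 b; have := sqr_ge0 c; have := sqr_ge0 d.
rewrite !sqrrD !sqrrN => *; rewrite ler_norml; apply/andP; split; lra.
Qed.

Lemma L2ipC f g : L2ip f g = L2ip g f.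
Proof. by apply: eq_Rintegral => t _; rewrite mulrC (mulrC (im _)). Qed.

Lemma L2ipDl f g h : L2ip (f + g) h = L2ip f h + L2ip g h.
Proof.
rewrite -RintegralD//; [|exact: L2ip_integrable|exact: L2ip_integrable].
apply: eq_Rintegral => t _; rewrite [(f + g : L2) t]/(f t + g t).
by case: (f t) (g t) => a b [c d] /=; ring.
Qed.

Lemma L2ipZl a f g : L2ip (a *: f) g = a * L2ip f g.
Proof.
rewrite -RintegralZl//; last exact: L2ip_integrable.
apply: eq_Rintegral => t _; rewrite [(a *: f : L2) t]/(a *: f t).
by case: (f t) => b c /=; ring.
Qed.

Lemma L2ip_ge0 f : 0 <= L2ip f f.
Proof. by apply: Rintegral_ge0 => t _; rewrite -!expr2 addr_ge0// sqr_ge0. Qed.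

Lemma L2ip_energy (f : L2) : (L2ip f f)%:E = energy (f : R -> R[i]).
Proof.
have /L2funE[_ Ef] := L2valP f.
rewrite /L2ip /Rintegral fineK.
  by apply: eq_integral => t _.
by apply: integrable_fin_num => //; exact: L2ip_integrable.
Qed.

End L2Space.

(** * From the real to the complex dimension count *)

Section ComplexCount.
Variable R : realType.
Implicit Types (c : R[i]) (u w : R -> R[i]).

Let phase (b : bool) : R[i] := if b then 'i%C else 1.

(** Functions that are not square integrable go to the default 0, hence the [L2fun] assumptions
    below. *)
Definition toL2 u : L2 R := insubd (0 : L2 R) (u : R -> Rcomplex R).

Lemma toL2K u : L2fun u -> L2val (toL2 u) = u.
Proof. by move=> Lu; apply: (@insubdK _ _ (L2 R)); apply/asboolP. Qed.

(* A complex span is the real span of the generators and their multiples by [i],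
   so passing to real scalars doubles both sides of the dimension count. *)
Definition realify (ws : seq (R -> R[i])) : seq (L2 R) :=
  [seq toL2 w | w <- ws] ++ [seq toL2 (phase true *: w) | w <- ws].

Lemma span_realify (ws : seq (R -> R[i])) u :
  (forall w, w \in ws -> L2fun w) -> span [set` ws] u ->
  span [set` realify ws] (toL2 u).
Proof.
move=> Lws; elim=> [|c x y /= xs sy IH].
  have -> : toL2 0 = 0 by apply: val_inj; rewrite /= toL2K//; exact: L2fun0.
  exact: span0.
have Lx := Lws _ xs; have Ly : L2fun y by apply: L2fun_span sy => w /Lws.
have -> : toL2 (c *: x + y) =
    complex.Re c *: toL2 x + (complex.Im c *: toL2 (phase true *: x) + toL2 y).
  apply: val_inj => /=.
  rewrite toL2K; last by apply: L2funD => //; exact: L2funZ.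
  rewrite !toL2K//; last exact: L2funZ.
  apply/funext => t; rewrite !fctE.
  case: c (x t) (y t) => a b [p q] [r s].
  by apply/eqP; rewrite eq_complex /=; apply/andP; split; apply/eqP; ring.
apply: span_cons; first by rewrite /= /realify mem_cat map_f.
apply: span_cons => //.
by rewrite /= /realify mem_cat; apply/orP; right; apply/mapP; exists x.
Qed.

(** Each [f i] contributes two real vectors, itself and its multiple by i. Separation survives
    although each is now a competitor of the other: 1 and i are orthogonal over the reals, so
    subtracting a real multiple of one from the other only increases the coefficient of [f i]. *)
Lemma card_le_approx_dim_complex (I : finType) (f : I -> R -> R[i])
    (ws : seq (R -> R[i])) (delta eps : R) :
  0 < delta -> 0 <= eps ->
  (forall i, L2fun (f i)) -> (forall w, w \in ws -> L2fun w) ->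
  (forall i u, span [set f j | j in [set j | j != i]] u ->
    ((delta ^+ 2)%:E <= energy (f i - u)%R)%E) ->
  (forall i, exists2 u, span [set` ws] u & (energy (f i - u)%R <= (eps ^+ 2)%:E)%E) ->
  #|I|%:R * (1 - eps / delta) <= (size ws)%:R.
Proof.
move=> d0 e0 Lf Lws fd fe.
pose F (p : I * bool) : L2 R := toL2 (phase p.2 *: f p.1).
have LF p : L2fun (phase p.2 *: f p.1) by exact: L2funZ.
have FE p : L2val (F p) = phase p.2 *: f p.1 by rewrite toL2K.
have Fd p (u : L2 R) : span [set F q | q in [set q | q != p]] u ->
    delta ^+ 2 <= L2ip (F p - u) (F p - u).
  case: p => i b su.
  (* The competitors with the same index [i] all have the other phase; their real multiples are
     collected in [c]. *)
  have [c [v [sv uE]]] : exists (c : R) v, span [set f j | j in [set j | j != i]] v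
      /\ L2val u = (c%:C%C * phase (~~ b)) *: f i + v.
    elim: su => [|a _ y [[j b'] /= qp <-] _ [c [v [sv yE]]]].
      by exists 0, 0; split; [exact: span0 | rewrite mul0r scale0r addr0].
    have valE : L2val (a *: F (j, b') + y) =
        (a%:C%C * phase b') *: f j + ((c%:C%C * phase (~~ b)) *: f i + v).
      by rewrite [LHS]/= yE FE rscaleE scalerA.
    have [ij|ij] := eqVneq j i.
      exists (a + c), v; split => //; rewrite [LHS]valE ij.
      have -> : b' = ~~ b.
        by move: qp; rewrite ij xpair_eqE eqxx /=; case: (b) (b') => -[].
      by rewrite addrA -scalerDl -mulrDl rmorphD.
    exists c, ((a%:C%C * phase b') *: f j + v); split.
      by apply: span_cons => //; exists j.
    by rewrite [LHS]valE addrCA.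
  rewrite -lee_fin L2ip_energy.
  (* The total coefficient of [f i] in [F (i, b) - u]; its squared modulus is [1 + c ^+ 2]. *)
  pose z := phase b - c%:C%C * phase (~~ b).
  have z1 : 1 <= csq z.
    by rewrite /z /phase /csq; case: b {su uE z} => /=; have := sqr_ge0 c; lra.
  have z0 : z != 0 by apply: contraTneq z1 => ->; rewrite csq0 -ltNge.
  have -> : (F (i, b) - u : L2 R) = z *: (f i - z^-1 *: v) :> (R -> R[i]).
    transitivity (phase b *: f i - ((c%:C%C * phase (~~ b)) *: f i + v)).
      by rewrite -uE -(FE (i, b)).
    rewrite scalerBr scalerA mulfV// scale1r.
    by rewrite /z scalerBl opprD addrA.
  have Lv : L2fun v by apply: L2fun_span sv => _ [j _ <-].
  rewrite energyZ; last first.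
    by apply: cmeasurableB; [have /L2funE[] := Lf i | apply: cmeasurableZ; have /L2funE[] := Lv].
  apply: le_trans (fd i _ (spanZ z^-1 sv)) _.
  by rewrite -[leLHS]mul1e; apply: lee_wpmul2r; rewrite ?energy_ge0// lee_fin.
have Fe p : exists2 u : L2 R, span [set` realify ws] u & L2ip (F p - u) (F p - u) <= eps ^+ 2.
  case: p => i b; have [u su ue] := fe i; exists (toL2 (phase b *: u)).
    by apply: span_realify => //; exact: spanZ.
  have Lu : L2fun u by apply: L2fun_span su => w /Lws.
  rewrite -lee_fin L2ip_energy; apply: le_trans ue.
  rewrite [X in energy X](_ : _ = phase b *: (f i - u)).
    rewrite energyZ; last first.
      by apply: cmeasurableB; [have /L2funE[] := Lf i | have /L2funE[] := Lu].
    rewrite (_ : csq _ = 1) ?mul1e//.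
    by rewrite /csq /phase; case: b => /=; ring.
  rewrite [LHS]/(L2val (F (i, b)) - L2val (toL2 (phase b *: u))) FE.
  by rewrite toL2K ?scalerBr//; exact: L2funZ.
have := card_le_approx_dim (@L2ipC R) (@L2ipDl R) (@L2ipZl R) (@L2ip_ge0 R) d0 e0 Fd Fe.
rewrite card_prod card_bool size_cat !size_map natrM natrD.
by lra.
Qed.

End ComplexCount.

Lemma cscaleE (R : realType) (c : R[i]) (f : R -> R[i]) (t : R) : (c *: f) t = c * f t.
Proof. by []. Qed.

Lemma caddE (R : realType) (f g : R -> R[i]) (t : R) : (f + g) t = f t + g t.
Proof. by []. Qed.

Lemma cscaleAl (R : realType) (c : R[i]) (f g : R -> R[i]) : (c *: f) * g = c *: (f * g).
Proof. by apply/funext => t; rewrite fctE !cscaleE mulrA. Qed.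

(** * Polynomials converging to a step function *)

Section Threshold.
Variable R : realType.

(** The Brosowski-Deutsch polynomials of the elementary proof of Stone-Weierstrass: on [0,1] they
    tend to a step with jump at [1 / k]. The ring is arbitrary because they are evaluated at numbers
    and at functions. *)
Definition step_poly {T : pzRingType} (k n : nat) (y : T) : T :=
  1 - (1 - y ^+ n) ^+ (k ^ n).

Lemma bernoulli_ineq (z : R) n : -1 <= z -> 1 + n%:R * z <= (1 + z) ^+ n.
Proof.
move=> z1; elim: n => [|n IH]; first by rewrite mul0r addr0.
have n0 : 0 <= n%:R :> R by [].
rewrite exprS -natr1; apply: (@le_trans _ _ ((1 + z) * (1 + n%:R * z))).
  by have := sqr_ge0 z; nra.
by rewrite ler_wpM2l//; lra.
Qed.

Lemma step_poly_itv k n (y : R) : 0 <= y <= 1 -> 0 <= step_poly k n y <= 1.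
Proof.
move=> /andP[y0 y1]; have yn0 := exprn_ge0 n y0; have yn1 := exprn_ile1 n y0 y1.
have h0 : 0 <= 1 - y ^+ n by rewrite subr_ge0.
have h1 : 1 - y ^+ n <= 1 by rewrite gerBl.
by rewrite /step_poly subr_ge0 gerBl exprn_ge0// exprn_ile1.
Qed.

(** Bernoulli bounds the value by [(k%:R * y) ^+ n]. *)
Lemma step_poly_cvg0 (k : nat) (y : R) : 0 <= y <= 1 -> k%:R * y < 1 ->
  step_poly k n y @[n --> \oo] --> (0 : R).
Proof.
move=> y01 ky; have /andP[y0 y1] := y01.
apply: (@squeeze_cvgr _ _ _ _ (cst 0) (fun n => (k%:R * y) ^+ n)).
- apply: nearW => n; have /andP[-> _] /= := step_poly_itv k n y01.
  have := @bernoulli_ineq (- y ^+ n) (k ^ n); rewrite lerN2 exprn_ile1// => /(_ isT).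
  by rewrite /step_poly exprMn natrX; lra.
- exact: cvg_cst.
- by apply: cvg_expr; rewrite ger0_norm// mulr_ge0.
Qed.

(** Since [(1 - y ^+ n) * (1 + y ^+ n) <= 1], the distance to 1 is at most the inverse of
    [(1 + y ^+ n) ^+ (k ^ n)], which Bernoulli bounds below by [(k%:R * y) ^+ n]. *)
Lemma step_poly_cvg1 (k : nat) (y : R) : 0 <= y <= 1 -> 1 < k%:R * y ->
  step_poly k n y @[n --> \oo] --> (1 : R).
Proof.
move=> y01 ky; have /andP[y0 y1] := y01.
have ky0 : 0 < k%:R * y by lra.
suff h : (1 - y ^+ n) ^+ (k ^ n) @[n --> \oo] --> (0 : R).
  by rewrite -[X in _ --> X]subr0; apply: cvgB => //; exact: cvg_cst.
apply: (@squeeze_cvgr _ _ _ _ (cst 0) (fun n => ((k%:R * y)^-1) ^+ n)).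
- apply: nearW => n; have yn0 := exprn_ge0 n y0; have yn1 := exprn_ile1 n y0 y1.
  rewrite exprn_ge0 ?subr_ge0//= exprVn -[leRHS]mul1r ler_pdivlMr ?exprn_gt0//.
  have bd : (k%:R * y) ^+ n <= (1 + y ^+ n) ^+ (k ^ n).
    have := @bernoulli_ineq (y ^+ n) (k ^ n).
    by rewrite exprMn natrX => /(_ (le_trans (lerN10 _) yn0)); lra.
  apply: (@le_trans _ _ ((1 - y ^+ n) ^+ (k ^ n) * (1 + y ^+ n) ^+ (k ^ n))).
    by rewrite ler_wpM2l// exprn_ge0// subr_ge0.
  rewrite -exprMn -subr_sqr expr1n exprn_ile1// ?subr_ge0 ?exprn_ile1// ?gerBl ?sqr_ge0//.
- exact: cvg_cst.
- apply: cvg_expr; rewrite ger0_norm ?invr_ge0 ?(ltW ky0)//.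
  by rewrite invf_lt1.
Qed.

End Threshold.

(** * Trigonometric polynomials of period 1 *)

Section TrigPoly.
Variable R : realType.
Local Notation re := complex.Re.
Local Notation im := complex.Im.

Definition trig : set (R -> R[i]) :=
  span (range (fun (k : int) (t : R) => cexp2pi (k%:~R * t))).

Lemma trig_exp (k : int) : trig (fun t => cexp2pi (k%:~R * t)).
Proof. by apply: span_gen; exists k. Qed.

Lemma trig_cst (c : R[i]) : trig (cst c).
Proof.
rewrite (_ : cst c = c *: (fun t : R => cexp2pi (0%:~R * t))); first exact/spanZ/trig_exp.
by apply/funext => t; rewrite cscaleE mulr0z mul0r cexp2pi0 mulr1.
Qed.

(** Closure under products lets the step polynomials act on trigonometric polynomials. *)
Lemma trigM (p q : R -> R[i]) : trig p -> trig q -> trig (p * q).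
Proof.
move=> tp tq; elim: tp => [|c _ y [k _ <-] _ IH]; first by rewrite mul0r; exact: span0.
rewrite mulrDl; apply: spanD => //; rewrite cscaleAl; apply: spanZ.
elim: tq => [|d _ z [l _ <-] _ IH']; first by rewrite mulr0; exact: span0.
rewrite mulrDr; apply: spanD => //; rewrite mulrC cscaleAl; apply: spanZ.
rewrite (_ : _ * _ = (fun t => cexp2pi ((l + k)%:~R * t))); first exact: trig_exp.
by apply/funext => t; rewrite fctE intrD mulrDl cexp2piD.
Qed.

Lemma trigX (p : R -> R[i]) n : trig p -> trig (p ^+ n).
Proof.
move=> tp; elim: n => [|n IH]; first by rewrite expr0; exact: (trig_cst 1).
by rewrite exprS; exact: trigM.
Qed.

Lemma trig_step_poly k n (p : R -> R[i]) : trig p -> trig (step_poly k n p).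
Proof.
move=> tp; have t1 : trig 1 by exact: (trig_cst 1).
by apply: spanB => //; apply: trigX; apply: spanB => //; exact: trigX.
Qed.

Lemma trig_cos (c : R) : trig (fun t => (cos (2 * pi * (t - c)))%:C%C).
Proof.
rewrite (_ : (fun _ => _) =
  ((2^-1)%:C%C * cexp2pi (- c)) *: (fun t : R => cexp2pi (1%:~R * t)) +
  ((2^-1)%:C%C * cexp2pi c) *: (fun t : R => cexp2pi ((-1)%:~R * t))).
  by apply: spanD; apply: spanZ; exact: trig_exp.
apply/funext => t; rewrite caddE !cscaleE -!mulrA -!cexp2piD -mulrDr.
rewrite mulrN1z mulN1r mul1r (_ : - c + t = t - c); last by ring.
rewrite (_ : c - t = - (t - c)); last by ring.
rewrite /cexp2pi mulrN cosN sinN.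
by apply/eqP; rewrite eq_complex/=; apply/andP; split; apply/eqP; rewrite ?mulrA; field.
Qed.

End TrigPoly.

(** * Indicators of intervals and their approximation by atoms *)

Section Cells.
Variable R : realType.
Local Notation mu := (@lebesgue_measure R).
Implicit Types (a b c d r t : R).

Definition cell c d : R -> R[i] := fun t => ((c <= t < d)%R%:R : R)%:C%C.

Lemma cellE c d : cell c d = (fun t => (\1_`[c, d[ t)%:C%C).
Proof.
by apply/funext => t; rewrite /cell indicE mem_setE in_itv.
Qed.

Lemma cmeasurable_cell c d : cmeasurable (cell c d).
Proof. by rewrite cellE; apply: cmeasurable_real; exact: measurable_indic. Qed.

Lemma energy_cell c d : c <= d -> energy (cell c d) = (d - c)%:E.
Proof.
move=> cd; transitivity (\int[mu]_t (\1_`[c, d[ t)%:E)%E.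
  apply: eq_integral => t _; rewrite cellE csq_real indicE.
  by case: (_ \in _); rewrite ?expr1n ?expr0n.
rewrite integral_indic//= setIT lebesgue_measure_itv/= lte_fin.
by move: cd; rewrite le_eqVlt => /predU1P[->|->]; rewrite ?ltxx ?subrr.
Qed.

Lemma L2fun_cell c d : L2fun (cell c d).
Proof.
apply/L2funE; split; first exact: cmeasurable_cell.
have [cd|dc] := leP c d; first by rewrite energy_cell// ltry.
rewrite /energy integral0_eq// => t _; rewrite /cell.
suff -> : (c <= t < d) = false by rewrite csq0.
by apply/negbTE/negP => /andP[ct td]; move: (lt_trans (le_lt_trans ct td) dc); rewrite ltxx.
Qed.

Definition box_atom (p : int * int) : R -> R[i] := tfshift (cell 0 1) (p.1%:~R, p.2%:~R).

(** The centre is real although the indices are integers, so that boxes can follow an arbitrary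
    shift. *)
Definition box a b r : set (R -> R[i]) :=
  [set box_atom p | p in [set p : int * int | `|p.1%:~R - a| <= r /\ `|p.2%:~R - b| <= r]].

Lemma L2fun_box_atom p : L2fun (box_atom p).
Proof. exact/L2fun_tfshift/L2fun_cell. Qed.

Lemma L2fun_box a b r u : span (box a b r) u -> L2fun u.
Proof. by apply: L2fun_span => _ [p _ <-]; exact: L2fun_box_atom. Qed.

Lemma box_sub a b r a' b' r' : `|a - a'| + r <= r' -> `|b - b'| + r <= r' ->
  box a b r `<=` box a' b' r'.
Proof.
move=> ha hb _ [p [pa pb] <-]; exists p => //; split.
  by rewrite -(subrKA a) (le_trans (ler_normD _ _))// addrC (le_trans _ ha)// lerD2l.
by rewrite -(subrKA b) (le_trans (ler_normD _ _))// addrC (le_trans _ hb)// lerD2l.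
Qed.

Lemma tfshiftD (f g : R -> R[i]) ab : tfshift (f + g) ab = tfshift f ab + tfshift g ab.
Proof. by apply/funext => t; rewrite !caddE /tfshift caddE mulrDr. Qed.

Lemma tfshiftZ (z : R[i]) (f : R -> R[i]) ab : tfshift (z *: f) ab = z *: tfshift f ab.
Proof. by apply/funext => t; rewrite cscaleE /tfshift cscaleE mulrCA. Qed.

Lemma tfshiftB (f g : R -> R[i]) ab : tfshift (f - g) ab = tfshift f ab - tfshift g ab.
Proof. by rewrite -scaleN1r tfshiftD tfshiftZ scaleN1r. Qed.

Lemma tfshift0 ab : tfshift (0 : R -> R[i]) ab = 0.
Proof. by apply/funext => t; rewrite /tfshift/= mulr0. Qed.

Lemma tfshift_tfshift (f : R -> R[i]) a b c d :
  tfshift (tfshift f (a, b)) (c, d) = cexp2pi (- (b * c)) *: tfshift f (a + c, b + d).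
Proof.
apply/funext => t; rewrite cscaleE /tfshift/= !mulrA -!cexp2piD.
by congr (cexp2pi _ * f _); ring.
Qed.

(** An integer shift of an atom is a multiple of another atom, so spans are carried along
    exactly. *)
Lemma span_box_shift a b r u (m n : int) : span (box a b r) u ->
  span (box (a + m%:~R) (b + n%:~R) r) (tfshift u (m%:~R, n%:~R)).
Proof.
elim=> [|z _ y [p [pa pb] <-] _ IH]; first by rewrite tfshift0; exact: span0.
rewrite tfshiftD tfshiftZ tfshift_tfshift scalerA; apply: span_cons => //.
exists (p.1 + m, p.2 + n) => /=; last by rewrite /box_atom/= !intrD.
by rewrite !intrD; split; [move: pa|move: pb]; congr (`|_| <= r); ring.
Qed.

Lemma trig_box (p : R -> R[i]) : trig p ->
  exists2 r, 0 <= r & span (box 0 0 r) (p * cell 0 1).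
Proof.
elim=> [|z _ y [k _ <-] _ [r r0 IH]].
  by exists 0 => //; rewrite mul0r; exact: span0.
exists (Num.max r `|k%:~R|); first by rewrite le_max r0.
rewrite mulrDl cscaleAl; apply: span_cons.
  exists (0, k) => /=; first by rewrite !subr0 normr0 !le_max r0 lexx orbT.
  by apply/funext => t; rewrite /box_atom /tfshift/= subr0.
apply: span_mono IH; apply: box_sub; rewrite subrr normr0 add0r le_max lexx//.
Qed.

Lemma step_polyE k n (x : R -> R) t :
  step_poly k n (fun t => (x t)%:C%C) t = (step_poly k n (x t))%:C%C.
Proof.
have fX (f : R -> R[i]) l : (f ^+ l) t = f t ^+ l.
  by elim: l => // l IH; rewrite !exprS -IH.
have fB (f : R -> R[i]) : (1 - f) t = 1 - f t by [].
rewrite /step_poly rmorphB rmorphXn rmorphB rmorphXn rmorph1.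
by rewrite fB fX fB fX.
Qed.

Lemma cell_limit c d : 0 <= c -> c < d -> d <= 1 -> d - c < 1 ->
  exists (x : R -> R) (k : nat),
  [/\ trig (fun t => (x t)%:C%C), forall t, 0 <= x t <= 1 &
      forall t, t != 0 -> t != c -> t != d -> 0 <= t < 1 ->
      step_poly k n (x t) @[n --> \oo] --> ((c <= t < d)%R%:R : R)].
Proof.
move=> c0 cd d1 dc1; pose m := (c + d) / 2; pose w := (d - c) / 2.
pose q t := (1 + cos (2 * pi * (t - m))) / 2.
pose th := (1 + cos (2 * pi * w)) / 2.
have pi0 := pi_gt0 R.
have w0 : 0 < w by rewrite /w; lra.
have w2 : w < 1/2 by rewrite /w; lra.
have pi20 : 0 < 2 * pi :> R by rewrite mulr_gt0.
have piE : 2 * pi * (1/2) = pi :> R by field.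
have mono (x y : R) : 0 <= x <= 1/2 -> 0 <= y <= 1/2 -> x < y ->
    cos (2 * pi * y) < cos (2 * pi * x).
  have ang (z : R) : 0 <= z <= 1/2 -> 2 * pi * z \in `[0, pi].
    move=> /andP[z0 z1]; move: z1; rewrite -(ler_pM2l pi20) piE in_itv/= => ->.
    by rewrite andbT mulr_ge0// ltW.
  by move=> /ang x2 /ang y2 xy; rewrite ltr_cos// ltr_pM2l.
(* [d - c < 1] makes the half-width [w] less than half a period, so the cosine at the ends is above
   -1. *)
have th0 : 0 < th.
  have : cos (2 * pi * (1 / 2)) < cos (2 * pi * w) by apply: mono; lra.
  by rewrite piE cospi /th => ?; apply: divr_gt0 => //; lra.
have q01 t : 0 <= q t <= 1.
  by rewrite /q; have := cos_geN1 (2 * pi * (t - m)); have := cos_le1 (2 * pi * (t - m)); lra.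
(* [k] exceeds [1 / th], so the factor [s] below is at most 1 and [s * q t] stays in [0,1]. *)
pose k := (Num.truncn th^-1).+1.
have kth : 1 < k%:R * th.
  by rewrite -ltr_pdivrMr// mul1r /k truncnS_gt.
pose s := (k%:R * th)^-1.
have k0 : 0 < k%:R :> R by rewrite ltr0n.
have s0 : 0 < s by rewrite invr_gt0; lra.
have s1 : s <= 1 by rewrite invf_le1; lra.
have kx t : k%:R * (s * q t) = q t / th by rewrite /s; field; rewrite ?gt_eqF.
have x01 t : 0 <= s * q t <= 1.
  by have /andP[? ?] := q01 t; rewrite mulr_ge0 ?(ltW s0)//= mulr_ile1 ?(ltW s0).
exists (fun t => s * q t), k; split => //.
  rewrite (_ : (fun _ => _) = (s / 2)%:C%C *: (cst 1 + (fun t => (cos (2 * pi * (t - m)))%:C%C))).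
    by apply: spanZ; apply: spanD; [exact: trig_cst | exact: trig_cos].
  apply/funext => t; rewrite cscaleE caddE /q -(rmorph1 (real_complex R)) -rmorphD -rmorphM.
  by congr (_%:C%C); field.
move=> t t0 tc td /andP[t0' t1].
have cosE (y : R) : cos (2 * pi * `|y|) = cos (2 * pi * y).
  by case: (ger0P y) => // _; rewrite mulrN cosN.
have [ctd|ctd] := boolP (c <= t < d).
  apply: step_poly_cvg1 => //; rewrite kx ltr_pdivlMr// mul1r /th /q.
  rewrite ltr_pM2r ?invr_gt0// ltrD2l -(cosE (t - m)); apply: mono; [|lra|].
  - rewrite normr_ge0/= ler_norml /m; move: ctd tc => /andP[? ?] _; apply/andP; split; lra.
  - rewrite ltr_norml /m /w; move: ctd => /andP[ct tdd].
    have : c < t by rewrite lt_def tc.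
    by move=> ?; apply/andP; split; lra.
apply: step_poly_cvg0 => //; rewrite kx ltr_pdivrMr// mul1r /th /q.
rewrite ltr_pM2r ?invr_gt0// ltrD2l -(cosE (t - m)).
have wt : w < `|t - m|.
  move: ctd; rewrite negb_and -ltNge -leNgt => /orP[tltc|dlet].
    by rewrite ltr_normr; apply/orP; right; rewrite /w /m; lra.
  have : d < t by rewrite lt_def td.
  by move=> ?; rewrite ltr_normr; apply/orP; left; rewrite /w /m; lra.
have tw : `|t - m| < 1 - w.
  have : 0 < t by rewrite lt_def t0.
  by move=> ?; rewrite ltr_norml /w /m; apply/andP; split; lra.
(* Past half a period, periodicity replaces the distance to [m] by its complement to 1, which still
   exceeds [w]. *)
have [h|h] := leP `|t - m| (1/2); first by apply: mono => //; rewrite ?normr_ge0//; lra.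
rewrite (_ : 2 * pi * `|t - m| = - (2 * pi * (1 - `|t - m|)) + pi *+ 2); last by ring.
by rewrite cosD2pi cosN; apply: mono; lra.
Qed.

(** Dominated convergence: on [0,1) both functions have values in [0,1] and elsewhere both vanish,
    so the indicator of [0,1) dominates the squared difference. *)
Lemma cell_approx c d e : 0 <= c -> c < d -> d <= 1 -> d - c < 1 -> 0 < e ->
  exists2 r, 0 <= r & exists2 u, span (box 0 0 r) u &
    (energy (cell c d - u)%R <= e%:E)%E.
Proof.
move=> c0 cd d1 dc1 e0; have [x [k [tx x01 xlim]]] := cell_limit c0 cd d1 dc1.
pose u n := step_poly k n (fun t => (x t)%:C%C) * cell 0 1.
have ur n : exists2 r, 0 <= r & span (box 0 0 r) (u n).
  by apply: trig_box; exact: trig_step_poly.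
have diffE n t : csq ((cell c d - u n) t) =
    ((c <= t < d)%R%:R - step_poly k n (x t) * (0 <= t < 1)%R%:R) ^+ 2.
  rewrite -csq_real; congr csq; rewrite rmorphB rmorphM /=.
  by rewrite -step_polyE.
have mu_ n : cmeasurable (cell c d - u n).
  apply: cmeasurableB; first exact: cmeasurable_cell.
  by have [r _ /L2fun_box/L2funE[]] := ur n.
have lim0 : energy (cell c d - u n) @[n --> \oo] --> 0%E.
  have := @dominated_convergence _ _ R mu setT measurableT
    (fun n t => (csq ((cell c d - u n) t))%:E) (cst 0%E) (fun t => (\1_`[0, 1[ t)%:E).
  rewrite integral0; case => //.
  - by move=> n; exact: measurable_ecsq.
  - exists [set 0; c; d]; split.
    + by apply: measurableU; [apply: measurableU|]; exact: measurable_set1.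
    + apply: countable_lebesgue_measure0; apply: finite_set_countable.
      by rewrite !finite_setU; do ![split]; exact: finite_set1.
    + move=> t /=; apply: contra_notP => /not_orP[/not_orP[/eqP t0 /eqP tc] /eqP td] _.
      under eq_fun do rewrite diffE.
      apply: cvg_EFin; first exact: nearW.
      have [t01|t01] := boolP (0 <= t < 1); last first.
        have -> : (c <= t < d) = false.
          by apply: contraNF t01 => /andP[ct td']; apply/andP; split; lra.
        rewrite [X in X @ _](_ : _ = cst 0); first exact: cvg_cst.
        by apply/funext => n /=; rewrite mulr0 subr0 expr0n.
      rewrite [X in _ --> X](_ : _ = ((c <= t < d)%R%:R - (c <= t < d)%R%:R) ^+ 2); last first.
        by rewrite subrr expr0n.
      pose v n := (c <= t < d)%R%:R - step_poly k n (x t).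
      rewrite [X in X @ _](_ : _ = v \* v); last first.
        by apply/funext => n /=; rewrite mulr1 expr2.
      rewrite expr2; apply: cvgM; (apply: cvgB; [exact: cvg_cst | exact: xlim]).
  - exact: (integrable_indic_itv 0 1 true true).
  - apply: aeW => t n _; rewrite gee0_abs ?lee_fin ?csq_ge0// diffE indicE mem_setE in_itv/=.
    have /andP[p0 p1] := step_poly_itv k n (x01 t).
    have [t01|t01] := boolP (0 <= t < 1).
      by case: (c <= t < d) => /=; rewrite mulr1 ?mulr1n ?mulr0n; nra.
    have -> : (c <= t < d) = false.
      by apply: contraNF t01 => /andP[ct td']; apply/andP; split; lra.
    by rewrite mulr0 subr0 expr0n.
have [N _ /(_ N (leqnn N))] : \forall n \near \oo, (energy (cell c d - u n)%R < e%:E)%E.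
  by apply: (lim0 [set y | (y < e%:E)%E]); apply: open_nbhs_nbhs; split;
    [exact: open_ereal_lt_ereal | rewrite /= lte_fin].
move=> /ltW le; have [r r0 su] := ur N.
by exists r => //; exists (u N).
Qed.

End Cells.

(** * The homogeneous approximation property *)

Section HomogeneousApproximation.
Variable R : realType.
Implicit Types (f g u : R -> R[i]) (a b c d e r t x : R).

(** What matters is the order of quantifiers: [r] is chosen before the shift. The error [e] bounds
    the squared norm. *)
Definition HAP f := forall e, 0 < e -> exists2 r, 0 <= r & forall a b,
  exists2 u, span (box a b r) u & (energy (tfshift f (a, b) - u)%R <= e%:E)%E.

Lemma energyD_le f g e1 e2 : cmeasurable f -> cmeasurable g ->
  (energy f <= e1%:E)%E -> (energy g <= e2%:E)%E ->
  (energy (f + g)%R <= (2 * e1 + 2 * e2)%:E)%E.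
Proof.
move=> mf mg fe ge; apply: le_trans (energyD mf mg) _.
by rewrite [leRHS]EFinD !EFinM; apply: leeD; apply: lee_wpmul2l.
Qed.

Lemma cmeasurable_box a b r u : span (box a b r) u -> cmeasurable u.
Proof. by move=> /L2fun_box/L2funE[]. Qed.

Lemma HAPD f g : cmeasurable f -> cmeasurable g -> HAP f -> HAP g -> HAP (f + g).
Proof.
move=> mf mg Hf Hg e e0; have e4 : 0 < e / 4 by rewrite divr_gt0.
have [r1 r10 H1] := Hf _ e4; have [r2 r20 H2] := Hg _ e4.
exists (r1 + r2); first exact: addr_ge0.
move=> a b; have [u su ue] := H1 a b; have [v sv ve] := H2 a b.
exists (u + v).
  by apply: spanD; [apply: span_mono su | apply: span_mono sv];
    apply: box_sub; rewrite subrr normr0 add0r ?lerDl ?lerDr.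
rewrite tfshiftD opprD addrACA.
have -> : e = 2 * (e / 4) + 2 * (e / 4) by field.
apply: energyD_le => //; apply: cmeasurableB.
- exact: cmeasurable_tfshift.
- exact: cmeasurable_box su.
- exact: cmeasurable_tfshift.
- exact: cmeasurable_box sv.
Qed.

Lemma HAPZ (z : R[i]) f : cmeasurable f -> HAP f -> HAP (z *: f).
Proof.
move=> mf Hf e e0; have z0 := csq_ge0 z.
(* The added 1 covers [z = 0]. *)
have e' : 0 < e / (csq z + 1) by rewrite divr_gt0//; lra.
have [r r0 H] := Hf _ e'; exists r => // a b; have [u su ue] := H a b.
exists (z *: u); first exact: spanZ.
rewrite tfshiftZ -scalerBr energyZ; last first.
  by apply: cmeasurableB; [exact: cmeasurable_tfshift | exact: cmeasurable_box su].
apply: (@le_trans _ _ ((csq z)%:E * (e / (csq z + 1))%:E)%E).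
  by apply: lee_wpmul2l => //; rewrite lee_fin.
rewrite -EFinM lee_fin mulrA ler_pdivrMr; last by lra.
by rewrite mulrC ler_pM2l//; lra.
Qed.

(** Shifts preserve the norm, so the radius found for an approximant [g] serves [f] as well. *)
Lemma HAP_limit f : cmeasurable f ->
  (forall e, 0 < e -> exists g,
    [/\ cmeasurable g, HAP g & (energy (f - g)%R <= e%:E)%E]) -> HAP f.
Proof.
move=> mf Hf e e0; have e4 : 0 < e / 4 by rewrite divr_gt0.
have [g [mg Hg fg]] := Hf _ e4; have [r r0 H] := Hg _ e4.
exists r => // a b; have [u su ue] := H a b; exists u => //.
rewrite -(subrKA (tfshift g (a, b))).
have -> : e = 2 * (e / 4) + 2 * (e / 4) by field.
have mfg := cmeasurableB mf mg.
rewrite -tfshiftB; apply: energyD_le => //.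
- exact: cmeasurable_tfshift.
- by apply: cmeasurableB; [exact: cmeasurable_tfshift | exact: cmeasurable_box su].
- by rewrite energy_tfshift.
Qed.

(** A shift is, up to a scalar, an integer shift after a fractional one, and integer shifts carry
    boxes to boxes. The radius grows by 1 to cover the fractional parts. *)
Lemma HAP_fundamental_domain f : cmeasurable f ->
  (forall e, 0 < e -> exists2 r, 0 <= r & forall a b, 0 <= a < 1 -> 0 <= b < 1 ->
    exists2 u, span (box 0 0 r) u & (energy (tfshift f (a, b) - u)%R <= e%:E)%E) ->
  HAP f.
Proof.
move=> mf Hf e e0; have [r r0 H] := Hf _ e0.
exists (r + 1); first by rewrite addr_ge0.
move=> a b; pose m := Num.floor a; pose n := Num.floor b.
have frac x : 0 <= x - (Num.floor x)%:~R < 1.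
  by have := floor_itv x; rewrite intrD => /andP[h1 h2]; apply/andP; split; lra.
have [u su ue] := H _ _ (frac a) (frac b).
(* Cancels the scalar produced by composing the two shifts. *)
pose z := cexp2pi ((b - n%:~R) * m%:~R).
have fE : tfshift f (a, b) = z *: tfshift (tfshift f (a - m%:~R, b - n%:~R)) (m%:~R, n%:~R).
  rewrite tfshift_tfshift scalerA /z mulrC cexp2piK scale1r.
  by congr (tfshift f (_, _)); ring.
exists (z *: tfshift u (m%:~R, n%:~R)).
  apply: spanZ; apply: span_mono (span_box_shift m n su); rewrite !add0r.
  apply: box_sub; rewrite distrC ger0_norm; have /andP[h1 h2] := frac a;
    have /andP[h3 h4] := frac b; rewrite -/m -/n in h1 h2 h3 h4; lra.
have mfu : cmeasurable (tfshift f (a - m%:~R, b - n%:~R) - u).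
  by apply: cmeasurableB; [exact: cmeasurable_tfshift | exact: cmeasurable_box su].
rewrite fE -scalerBr -tfshiftB energyZ; last exact: cmeasurable_tfshift.
by rewrite csq_cexp2pi mul1e energy_tfshift.
Qed.

(** The grid cell lies in a unit interval with integer ends; an integer translation brings it into
    [0,1]. [1 < K] keeps its length below 1, as the cosine threshold requires. *)
Lemma cell_grid_approx (K n L : nat) e : (1 < K)%N -> 0 < e ->
  exists2 r, 0 <= r & exists2 u, span (box 0 0 r) u &
    (energy (cell (n%:R / K%:R - L%:R) (n.+1%:R / K%:R - L%:R) - u)%R <= e%:E)%E.
Proof.
move=> K1 e0; have K0 : 0 < K%:R :> R by rewrite ltr0n (ltn_trans _ K1).
have K1' : 1 < K%:R :> R by rewrite ltr1n.
pose i := (n %/ K)%N; pose j := (n %% K)%N.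
have jK : (j < K)%N by rewrite ltn_mod (ltn_trans _ K1).
have nE : n%:R = i%:R * K%:R + j%:R :> R by rewrite -natrM -natrD -divn_eq.
have jK' : j.+1%:R <= K%:R :> R by rewrite ler_nat.
have j0 : 0 <= j%:R :> R by [].
have [|||||r r0 [u su ue]] := @cell_approx R (j%:R / K%:R) (j.+1%:R / K%:R) e.
- by rewrite divr_ge0// ltW.
- by rewrite ltr_pM2r ?invr_gt0// ltr_nat.
- by rewrite ler_pdivrMr// mul1r.
- by rewrite -mulrBl -natr1 addrAC subrr add0r mul1r invf_lt1.
- exact: e0.
pose m : int := i%:Z - L%:Z.
have mE : m%:~R = i%:R - L%:R :> R by rewrite /m intrB.
exists (r + `|m%:~R|); first by rewrite addr_ge0.
exists (tfshift u (m%:~R, 0%:~R)).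
  apply: span_mono (span_box_shift m 0 su); rewrite !add0r mulr0z.
  by apply: box_sub; rewrite !subr0 ?normr0 ?add0r ?lerDl// addrC.
have -> : @cell R (n%:R / K%:R - L%:R) (n.+1%:R / K%:R - L%:R) =
    tfshift (cell (j%:R / K%:R) (j.+1%:R / K%:R)) (m%:~R, 0%:~R).
  apply/funext => t; rewrite /tfshift/= mul0r cexp2pi0 mul1r /cell.
  congr (_%:R%:C%C); rewrite lerBrDr ltrBlDr mE -[n.+1%:R]natr1 -[j.+1%:R]natr1 nE.
  congr (_ && _).
    by congr (_ <= _); field; rewrite gt_eqF.
  by congr (_ < _); field; rewrite gt_eqF.
rewrite -tfshiftB energy_tfshift//.
by apply: cmeasurableB; [exact: cmeasurable_cell | exact: cmeasurable_box su].
Qed.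

(** The exponential constant is harmless: the accuracy of the terms will be chosen after their
    number. *)
Lemma energy_sum (I : Type) (s : seq I) (F : I -> R -> R[i]) e : 0 <= e ->
  (forall i, cmeasurable (F i)) -> (forall i, (energy (F i) <= e%:E)%E) ->
  cmeasurable (\sum_(i <- s) F i) /\
  (energy (\sum_(i <- s) F i)%R <= (4 ^+ size s * e)%:E)%E.
Proof.
move=> e0 mF Fe; elim: s => [|i s [IHm IHe]].
  rewrite big_nil; split; first exact: (cmeasurable_cst 0).
  rewrite /energy integral0_eq ?lee_fin ?expr0 ?mul1r// => t _.
  by rewrite csq0.
rewrite big_cons; split; first exact: cmeasurableD.
apply: le_trans (energyD_le (mF i) IHm (Fe i) IHe) _.
rewrite lee_fin /= exprS.
have : 1 <= 4 ^+ size s :> R by rewrite exprn_ege1// ler1n.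
by nra.
Qed.

(** The squared modulus is 2 - 2 cos(2 pi (x - y)), so continuity of the cosine at 0 suffices. *)
Lemma cexp2pi_unif_continuous e : 0 < e -> exists2 d, 0 < d & forall x y : R,
  `|x - y| < d -> csq (cexp2pi x - cexp2pi y) <= e.
Proof.
move=> e0.
have cc : (fun z : R => cos (2 * pi * z)) @ (0 : R) --> cos (2 * pi * (0 : R)).
  apply: (@continuous_comp _ _ _ (fun z : R => 2 * pi * z) cos); last exact: continuous_cos.
  by apply: cvgM; [exact: cvg_cst | exact: cvg_id].
have /cvgrPdist_lt/(_ (e / 2)) := cc; rewrite divr_gt0// => /(_ isT).
move=> [d /= d0 H]; exists d => // x y xy.
have := H (x - y); rewrite /= sub0r normrN => /(_ xy).
rewrite mulr0 cos0 => /ltW; rewrite ler_norml => /andP[_ h].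
rewrite /csq /cexp2pi/=; move: h; rewrite mulrBr cosB.
have := cos2Dsin2 (2 * pi * x); have := cos2Dsin2 (2 * pi * y).
by move: (cos _) (cos _) (sin _) (sin _) => c1 c2 s1 s2; nra.
Qed.

(** Two errors of [e / 4]: from the shifted function to its step function on a grid, and from each
    grid cell to its approximation. Grid and cell approximations do not depend on [a] and [b], which
    only affect coefficients bounded by [B]; hence one radius. *)
Lemma HAP_unif_continuous (p : R -> R) (M B : R) : measurable_fun setT p ->
  0 <= M -> (forall x, M <= `|x| -> p x = 0) -> (forall x, `|p x| <= B) ->
  (forall e, 0 < e -> exists2 d, 0 < d & forall x y, `|x - y| < d -> `|p x - p y| <= e) ->
  HAP (fun t => (p t)%:C%C).
Proof.
move=> mp M0 pM pB pc.
pose f : R -> R[i] := fun t => (p t)%:C%C; rewrite -/f.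
have mf : cmeasurable f by exact: cmeasurable_real.
apply: HAP_fundamental_domain => // e e0.
have B0 : 0 <= B by apply: le_trans (normr_ge0 _) (pB 0).
pose G a b := tfshift f (a, b).
have GB a b t : csq (G a b t) <= B ^+ 2.
  rewrite csqM csq_cexp2pi mul1r csq_real -(real_normK (num_real _)).
  by rewrite ler_pXn2r ?nnegrE.
(* A translation by [a] in [0,1) moves the support by less than 1. *)
pose L := (Num.truncn (M + 1)).+1.
have ML : M + 1 < L%:R by rewrite /L truncnS_gt.
have L0 : 0 < L%:R :> R by rewrite ltr0n.
have GL a b t : 0 <= a < 1 -> ~~ (- L%:R <= t < L%:R) -> G a b t = 0.
  move=> /andP[a0 a1] tL; rewrite /G /tfshift /f/= pM ?mulr0//.
  move: tL; rewrite negb_and -ltNge -leNgt => /orP[h|h]; rewrite ler_normr;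
    apply/orP; [right|left]; lra.
(* Over an interval of length [2 * L], a squared error [eta] integrates to [e / 4]. *)
pose eta := e / (8 * L%:R).
have eta0 : 0 < eta by rewrite divr_gt0// mulr_gt0.
(* The modulus is uniform because [b] stays in [0,1): otherwise the modulation could oscillate
   arbitrarily fast. *)
have [dl dl0 Gc] : exists2 dl, 0 < dl & forall a b t x, 0 <= b < 1 ->
    `|t - x| < dl -> csq (G a b t - G a b x) <= eta.
  have [|d1 d10 H1] := pc (Num.sqrt (eta / 4)); first by rewrite sqrtr_gt0 divr_gt0.
  have [|d2 d20 H2] := @cexp2pi_unif_continuous (eta / (4 * (B ^+ 2 + 1))).
    by rewrite divr_gt0// mulr_gt0//; have := sqr_ge0 B; lra.
  exists (Num.min d1 d2); first by rewrite lt_min d10.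
  move=> a b t x /andP[b0 b1]; rewrite lt_min => /andP[t1 t2].
  have -> : G a b t - G a b x = cexp2pi (b * t) * (p (t - a) - p (x - a))%:C%C
      + (cexp2pi (b * t) - cexp2pi (b * x)) * (p (x - a))%:C%C.
    by rewrite /G /tfshift/= /f rmorphB /=; ring.
  apply: le_trans (csqD_le _ _) _; rewrite !csqM csq_cexp2pi mul1r !csq_real.
  have h1 : (p (t - a) - p (x - a)) ^+ 2 <= eta / 4.
    have e4 : 0 <= eta / 4 by rewrite divr_ge0// ltW.
    rewrite -(real_normK (num_real _)) -[leRHS]sqr_sqrtr//.
    rewrite ler_pXn2r ?nnegrE ?sqrtr_ge0//; apply: H1.
    by rewrite (_ : _ - _ = t - x) //; ring.
  have h2 : csq (cexp2pi (b * t) - cexp2pi (b * x)) <= eta / (4 * (B ^+ 2 + 1)).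
    apply: H2; rewrite -mulrBr normrM ger0_norm//; apply: le_lt_trans t2.
    by rewrite ler_piMl// ltW.
  have h3 : p (x - a) ^+ 2 <= B ^+ 2.
    by rewrite -(real_normK (num_real _)) ler_pXn2r ?nnegrE.
  have h4 : csq (cexp2pi (b * t) - cexp2pi (b * x)) * p (x - a) ^+ 2 <= eta / 4.
    apply: (@le_trans _ _ (eta / (4 * (B ^+ 2 + 1)) * (B ^+ 2 + 1))).
      apply: ler_pM => //; [exact: csq_ge0 | exact: sqr_ge0 | lra].
    rewrite le_eqVlt; apply/orP; left; apply/eqP; field.
    by rewrite gt_eqF//; have := sqr_ge0 B; lra.
  by lra.
pose K := (Num.truncn (dl^-1)).+2.
have K1 : (1 < K)%N by [].
have K0 : 0 < K%:R :> R by rewrite ltr0n.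
have Kdl : K%:R^-1 < dl.
  by rewrite invf_plt ?posrE// (lt_trans (truncnS_gt _))// ltr_nat.
pose N := (2 * L * K)%N.
pose left (n : nat) : R := n%:R / K%:R - L%:R.
(* Absorbs the constant of [energy_sum] and the squared samples; the added 1 covers [B = 0]. *)
pose e2 := e / (4 * (4 ^+ N * (B ^+ 2 + 1))).
have B1 : 0 < B ^+ 2 + 1 by have := sqr_ge0 B; lra.
have N0 : 0 < 4 ^+ N :> R by rewrite exprn_gt0.
have e20 : 0 < e2 by rewrite divr_gt0// mulr_gt0// mulr_gt0//.
have /choice[ru ruP] : forall n : nat, exists ru : R * (R -> R[i]),
    [/\ 0 <= ru.1, span (box 0 0 ru.1) ru.2 &
        (energy (cell (left n) (left n.+1) - ru.2)%R <= e2%:E)%E].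
  by move=> n; have [r r0 [u su ue]] := cell_grid_approx n L K1 e20; exists (r, u).
(* The sum serves as a common upper bound for the radii. *)
pose r := \sum_(n <- iota 0 N) (ru n).1.
exists r; first by apply: sumr_ge0 => n _; have [] := ruP n.
move=> a b a01 b01.
exists (\sum_(n <- iota 0 N) G a b (left n) *: (ru n).2).
  rewrite big_seq; apply: span_sum => n nN; apply: spanZ.
  have [_ su _] := ruP n; apply: span_mono su; apply: box_sub;
    rewrite subrr normr0 add0r /r (big_rem n)//= lerDl;
    by apply: sumr_ge0 => k _; have [] := ruP k.
pose s := \sum_(n <- iota 0 N) G a b (left n) *: cell (left n) (left n.+1).
rewrite -(subrKA s).
have mcell n : cmeasurable (G a b (left n) *: cell (left n) (left n.+1)).
  exact/cmeasurableZ/cmeasurable_cell.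
have ms : cmeasurable s.
  rewrite /s; apply: big_ind; [exact: (cmeasurable_cst 0) | exact: cmeasurableD |].
  by move=> n _; exact: mcell.
have mG : cmeasurable (tfshift f (a, b)) by exact: cmeasurable_tfshift.
have md n : cmeasurable (cell (left n) (left n.+1) - (ru n).2).
  have [_ su _] := ruP n.
  by apply: cmeasurableB; [exact: cmeasurable_cell | exact: cmeasurable_box su].
have [] := @energy_sum nat (iota 0 N)
    (fun n => G a b (left n) *: (cell (left n) (left n.+1) - (ru n).2)) (B ^+ 2 * e2) _ _ _.
- by rewrite mulr_ge0 ?sqr_ge0// ltW.
- by move=> n; exact: cmeasurableZ.
- move=> n; rewrite energyZ// EFinM; have [_ _ h] := ruP n.
  by apply: lee_pmul => //; rewrite ?lee_fin ?csq_ge0 ?energy_ge0.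
have -> : \sum_(n <- iota 0 N) G a b (left n) *: (cell (left n) (left n.+1) - (ru n).2)
    = s - \sum_(n <- iota 0 N) G a b (left n) *: (ru n).2.
  by rewrite -sumrB; apply: eq_bigr => n _; rewrite scalerBr.
rewrite size_iota => md' ed'.
(* Exactly one cell contains such a [t]; its left end is the last grid point not beyond [t]. *)
have sE t : s t = if (- L%:R <= t < L%:R) then G a b (left (Num.truncn ((t + L%:R) * K%:R)))
                  else 0.
  have -> : s t = \sum_(n <- iota 0 N) G a b (left n) * cell (left n) (left n.+1) t.
    rewrite /s; elim: (iota 0 N) => [|n l IH]; first by rewrite !big_nil.
    by rewrite !big_cons caddE IH.
  have cellt n : (left n <= t < left n.+1) = (n%:R <= (t + L%:R) * K%:R < n.+1%:R).
    by rewrite /left lerBlDr ltrBrDr ler_pdivrMr// ltr_pdivlMr.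
  case: ifPn => [/andP[tl tr]|tL]; last first.
    rewrite big1_seq// => n /andP[_]; rewrite mem_iota add0n => /andP[_ nN].
    rewrite /cell cellt (_ : (_ <= _ < _) = false) ?mulr0//.
    apply: contraNF tL => /andP[h1 h2].
    have hn : n.+1%:R <= 2 * L%:R * K%:R :> R by rewrite -!natrM ler_nat.
    have n0 : 0 <= n%:R :> R by [].
    have h3 : 0 <= (t + L%:R) * K%:R by exact: le_trans h1.
    have h4 : (t + L%:R) * K%:R < 2 * L%:R * K%:R by exact: lt_le_trans hn.
    move: h3 h4; rewrite pmulr_lge0// ltr_pM2r// => ? ?.
    by apply/andP; split; lra.
  set k := Num.truncn _.
  have tK0 : 0 <= (t + L%:R) * K%:R by rewrite mulr_ge0// ?(ltW K0)//; lra.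
  have kN : k \in iota 0 N.
    rewrite mem_iota leq0n add0n /= /k truncn_lt_nat// /N !natrM ltr_pM2r//.
    by lra.
  rewrite (big_rem k)// {1}/cell cellt (truncn_itv tK0) mulr1 big1_seq ?Monoid.mulm1//.
  move=> n /andP[_ nk]; rewrite /cell cellt (_ : (_ <= _ < _) = false) ?mulr0//.
  apply/negbTE/negP => h; have nkE : k = n := truncn_def h.
  by move: nk; rewrite nkE mem_rem_uniq ?iota_uniq// inE eqxx.
have ed : (energy (tfshift f (a, b) - s)%R <= (e / 4)%:E)%E.
  have LL : - L%:R <= L%:R :> R by lra.
  apply: (@le_trans _ _ (energy ((Num.sqrt eta)%:C%C *: cell (- L%:R) L%:R))).
    apply: energy_mono; [exact: cmeasurableB | exact/cmeasurableZ/cmeasurable_cell |].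
    move=> t; rewrite cscaleE csqM csq_real sqr_sqrtr ?(ltW eta0)//.
    rewrite [X in csq X]/(G a b t - s t) sE /cell.
    case: (boolP (- L%:R <= t < L%:R)) => tL; last first.
      by rewrite (GL a b t a01 tL) /= subr0 csq0 mulr_ge0 ?csq_ge0// ltW.
    rewrite [X in _ <= _ * X](_ : _ = 1) ?mulr1; last by rewrite csq_real expr1n.
    apply: Gc => //.
    have tK0 : 0 <= (t + L%:R) * K%:R.
      by move: tL => /andP[? ?]; rewrite mulr_ge0// ?(ltW K0)//; lra.
    have /andP[k1 k2] := truncn_itv tK0; move: k1 k2.
    rewrite /left -[X in _ < X]natr1; move: (Num.truncn _)%:R => k k1 k2.
    rewrite (_ : t - _ = ((t + L%:R) * K%:R - k) / K%:R); last first.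
      by field; rewrite gt_eqF.
    apply: lt_trans Kdl; rewrite normrM [X in _ * X]ger0_norm ?invr_ge0 ?(ltW K0)//.
    rewrite gtr_pMl ?invr_gt0// ger0_norm; lra.
  rewrite energyZ; last exact: cmeasurable_cell.
  rewrite energy_cell// csq_real sqr_sqrtr ?(ltW eta0)// -EFinM lee_fin.
  by rewrite le_eqVlt; apply/orP; left; apply/eqP; rewrite /eta; field; rewrite gt_eqF.
have mGs : cmeasurable (tfshift f (a, b) - s) by exact: cmeasurableB.
apply: le_trans (energyD_le mGs md' ed ed') _; rewrite lee_fin.
have : 4 ^+ N * (B ^+ 2 * e2) <= e / 4.
  apply: (@le_trans _ _ (4 ^+ N * ((B ^+ 2 + 1) * e2))).
    by rewrite ler_pM2l// ler_pM2r//; lra.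
  rewrite le_eqVlt; apply/orP; left; apply/eqP; rewrite /e2; field.
  by rewrite !gt_eqF.
by lra.
Qed.

End HomogeneousApproximation.

(** * Density of continuous functions of compact support *)

Section Density.
Variable R : realType.
Local Notation mu := (@lebesgue_measure R).
Implicit Types (p q h : R -> R) (e d t x y M N : R).

(** Compactness gives a modulus on a segment exceeding the support by 1; capping [d] at 1 makes both
    values vanish when [x] lies outside that segment. *)
Lemma compact_support_unif_continuous p M : continuous p ->
  (forall x, M <= `|x| -> p x = 0) ->
  forall e, 0 < e -> exists2 d, 0 < d & forall x y, `|x - y| < d -> `|p x - p y| <= e.
Proof.
move=> cp pM e e0.
have := @segment_compact R (- (M + 1)) (M + 1).
move=> /compact_near_coveringP/(_ R (0 : R)^'+
  (fun d x => forall y, `|x - y| < d -> `|p x - p y| <= e)) [].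
- move=> x _; have e2 : 0 < e / 2 by rewrite divr_gt0.
  have /cvgrPdist_lt/(_ _ e2)[/= d d0 pd] := cp x.
  have d2 : 0 < d / 2 by rewrite divr_gt0.
  exists (ball x (d / 2), [set d' | d' < d / 2]) => /=.
    by split; [exact: nbhsx_ballx | exact: nbhs_right_lt].
  move=> [x' d'] /= [xx' d'd] y x'y.
  have h1 : `|p x - p x'| < e / 2 by apply: pd; apply: lt_le_trans xx' _; lra.
  have h2 : `|p x - p y| < e / 2.
    apply: pd => /=; rewrite -(subrKA x'); apply: le_lt_trans (ler_normD _ _) _.
    by move: xx'; rewrite /ball /= => xx'; lra.
  rewrite -(subrKA (p x)); apply: le_trans (ler_normD _ _) _.
  by rewrite (distrC (p x')); lra.
- move=> d0 /= d0_gt0 pd; exists (Num.min (d0 / 2) 1).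
    by rewrite lt_min ltr01 divr_gt0.
  have d2d : 0 < d0 / 2 by rewrite divr_gt0.
  move=> x y; rewrite lt_min => /andP[xy1 xy2].
  have [xM|xM] := boolP (x \in `[- (M + 1), M + 1]).
    apply: (pd (d0 / 2)) => //=; rewrite sub0r normrN ger0_norm ?ltW//; lra.
  have {}xM : M + 1 < `|x|.
    by rewrite ltNge ler_norml; move: xM; rewrite in_itv.
  have yM : M < `|y| by have := ler_normD (x - y) y; rewrite subrK; lra.
  by rewrite !pM ?subrr ?normr0 ?(ltW e0)// ?(ltW yM)//; lra.
Qed.

(** Lets an approximant be cut to the bound [N] of its target without loss of accuracy. *)
Lemma clamp_le N v y : `|v| <= N ->
  `|Num.max (- N) (Num.min N y)| <= N /\ `|v - Num.max (- N) (Num.min N y)| <= `|v - y|.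
Proof.
move=> vN; have N0 : 0 <= N by apply: le_trans vN.
move: vN; rewrite ler_norml => /andP[v1 v2].
have [h1|h1] := leP N y.
  rewrite max_r; last lra.
  rewrite ger0_norm//; split => //.
  by rewrite ler0_norm ?subr_le0// ler0_norm ?subr_le0//; lra.
have [h2|h2] := leP (- N) y.
  by split => //; rewrite ler_norml h2 ltW.
rewrite normrN ger0_norm//; split => //.
by rewrite ger0_norm ?ger0_norm; lra.
Qed.

(** Cutting position and value at the same level gives functions that at each point eventually equal
    [p]; the square of [p] dominates the squared error. *)
Lemma L2_truncation p e : measurable_fun setT p ->
  (energy (fun t => (p t)%:C%C) < +oo)%E -> 0 < e ->
  exists N q, [/\ 0 < N, measurable_fun setT q, forall t, N < `|t| -> q t = 0,
    forall t, `|q t| <= N & (energy (fun t => (p t - q t)%:C%C) <= e%:E)%E].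
Proof.
move=> mp Ep e0.
pose q (n : nat) t := if Num.max `|t| `|p t| <= n.+1%:R then p t else 0.
have mq n : measurable_fun setT (q n).
  apply: measurable_fun_ifT => //.
  apply: measurable_fun_ler; last exact: measurable_cst.
  have mnorm : measurable_fun setT (fun t : R => `|t|).
    by apply: continuous_measurable_fun; exact: norm_continuous.
  exact: (measurable_maxr mnorm (measurableT_comp mnorm mp)).
have mpq n : cmeasurable (fun t => (p t - q n t)%:C%C).
  by apply: cmeasurable_real; exact: measurable_funB.
have lim0 : energy (fun t => (p t - q n t)%:C%C) @[n --> \oo] --> 0%E.
  have := @dominated_convergence _ _ R mu setT measurableT
    (fun n t => (csq ((p t - q n t)%:C%C))%:E) (cst 0%E) (fun t => (csq ((p t)%:C%C))%:E).
  rewrite integral0; case => //.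
  - by move=> n; exact: (measurable_ecsq (mpq n)).
  - apply: aeW => t _; apply: cvg_near_cst.
    exists (Num.truncn (Num.max `|t| `|p t|)) => //= n /= tn.
    rewrite /q ifT ?subrr ?csq0//.
    by apply: le_trans (ltW (truncnS_gt _)) _; rewrite ler_nat.
  - apply/integrableP; split; first exact: (measurable_ecsq (cmeasurable_real mp)).
    by under eq_integral do rewrite gee0_abs ?lee_fin ?csq_ge0//.
  - apply: aeW => t n _; rewrite gee0_abs ?lee_fin ?csq_ge0// !csq_real /q.
    by case: ifP => _; rewrite ?subr0// subrr expr0n sqr_ge0.
have [n _ /(_ n (leqnn n))] : \forall n \near \oo,
    (energy (fun t => (p t - q n t)%:C%C) < e%:E)%E.
  by apply: (lim0 [set y | (y < e%:E)%E]); apply: open_nbhs_nbhs; split;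
    [exact: open_ereal_lt_ereal | rewrite /= lte_fin].
move=> /ltW le; exists n.+1%:R, (q n); split => //.
- move=> t nt; rewrite /q ifF//; apply/negbTE; rewrite -ltNge.
  by rewrite lt_max nt.
- by move=> t; rewrite /q; case: ifPn; rewrite ?normr0// ge_max => /andP[].
Qed.

(** An L^1 approximation [h] on a bounded interval becomes an L^2 one: once [h] is cut to the bound
    [N], the squared error is at most [2 * N] times the L^1 error. Hence the accuracy [e / (2 * N)]
    asked in L^1. *)
Lemma L2_continuous_density p N e : measurable_fun setT p -> 0 < N ->
  (forall t, N < `|t| -> p t = 0) -> (forall t, `|p t| <= N) -> 0 < e ->
  exists q, [/\ continuous q, forall t, N + 1 <= `|t| -> q t = 0,
    forall t, `|q t| <= N & (energy (fun t => (p t - q t)%:C%C) <= e%:E)%E].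
Proof.
move=> mp N0 pN pB e0.
pose A : set R := `[- (N + 1), N + 1]%classic.
have mA : measurable A by exact: measurable_itv.
have muA : (mu A < +oo)%E.
  by rewrite lebesgue_measure_itv/=; case: ifP => _; rewrite ?ltry// -EFinB ltry.
have Ip : mu.-integrable A (EFin \o p).
  apply: measurable_bounded_integrable => //; first exact: measurable_funTS.
  by exists N; split; rewrite ?num_real// => x Nx t _ /=; exact: le_trans (pB t) (ltW Nx).
have [g [cg _ /= g0]] := approximation_continuous_integrable mA muA Ip.
have [n _ /(_ n (leqnn n))] : \forall n \near \oo,
    (\int[mu]_(z in A) `|(p z - g n z)%:E| < (e / (2 * N))%:E)%E.
  apply: (g0 [set y | (y < (e / (2 * N))%:E)%E]); apply: open_nbhs_nbhs; split.
    exact: open_ereal_lt_ereal.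
  by rewrite /= lte_fin divr_gt0// mulr_gt0.
move=> /ltW int_le; pose h := g n; have ch : continuous h by exact: cg.
(* A trapezoid, 1 on [-N, N] and 0 at distance at least [N + 1] from the origin; it makes the
   support compact. *)
pose cut t := Num.max 0 (Num.min 1 (N + 1 - `|t|)).
pose q t := cut t * Num.max (- N) (Num.min N (h t)).
have cut01 t : 0 <= cut t <= 1 by rewrite /cut le_max lexx/= ge_max ler01 ge_min lexx.
have clampB t : `|Num.max (- N) (Num.min N (h t))| <= N.
  by have [] := @clamp_le N 0 (h t) _; rewrite // normr0 ltW.
have qB t : `|q t| <= N.
  have /andP[c0 c1] := cut01 t; rewrite normrM ger0_norm//.
  by apply: le_trans (clampB t); rewrite ler_piMl.
have qN t : N + 1 <= `|t| -> q t = 0.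
  by move=> Nt; rewrite /q /cut max_l ?mul0r// ge_min; apply/orP; right; lra.
have cq : continuous q.
  move=> t; apply: (@continuousM R R cut) => /=.
    apply: (@continuous_max R R (cst 0)); first exact: cst_continuous.
    apply: (@continuous_min R R (cst 1)); first exact: cst_continuous.
    by apply: continuousB; [exact: cst_continuous | exact: norm_continuous].
  apply: (@continuous_max R R (cst (- N))); first exact: cst_continuous.
  by apply: (@continuous_min R R (cst N)); [exact: cst_continuous | exact: ch].
have mq := continuous_measurable_fun cq.
have mh := continuous_measurable_fun ch.
exists q; split => //.
have dE t : (p t - q t) ^+ 2 <= 2 * N * `|p t - h t|.
  have [c1 c2] := clamp_le (h t) (pB t).
  have d1 : `|p t - q t| <= 2 * N.
    by apply: le_trans (ler_normB _ _) _; have := pB t; have := qB t; lra.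
  rewrite -(real_normK (num_real _)) expr2; apply: ler_pM => //.
  have [tN|tN] := leP `|t| N.
    rewrite /q (_ : cut t = 1) ?mul1r//.
    by rewrite /cut min_l ?max_r//; lra.
  rewrite (pN _ tN) !sub0r !normrN in c2 *; apply: le_trans c2.
  by rewrite /q normrM; have /andP[k0 k1] := cut01 t; rewrite (ger0_norm k0) ler_piMl.
have mpq : cmeasurable (fun t => (p t - q t)%:C%C).
  by apply: cmeasurable_real; exact: measurable_funB.
have -> : energy (fun t => (p t - q t)%:C%C) =
    (\int[mu]_(t in A) (csq ((p t - q t)%:C%C))%:E)%E.
  rewrite [RHS]integral_mkcond; apply: eq_integral => t _; rewrite patchE.
  case: ifPn => // tA; rewrite pN ?qN ?subrr ?csq0//.
    by move: tA; rewrite notin_setE /A /= in_itv /= -ler_norml => /negP; rewrite -ltNge => /ltW.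
  by move: tA; rewrite notin_setE /A /= in_itv /= -ler_norml => /negP; rewrite -ltNge; lra.
apply: (@le_trans _ _ (\int[mu]_(t in A) ((2 * N)%:E * `|(p t - h t)%:E|))%E).
  apply: ge0_le_integral => //.
  - by move=> t _; rewrite lee_fin csq_ge0.
  - by apply: measurable_funTS; exact: (measurable_ecsq mpq).
  - apply: measurable_funTS; apply: measurable_funeM; apply: measurableT_comp => //.
    by apply/measurable_EFinP; exact: measurable_funB.
  - by move=> t _; rewrite csq_real -EFinM lee_fin.
rewrite ge0_integralZl//; last first.
- by rewrite lee_fin mulr_ge0// ltW.
- by apply: measurable_funTS; apply: measurableT_comp => //;
    apply/measurable_EFinP; exact: measurable_funB.
apply: (@le_trans _ _ ((2 * N)%:E * (e / (2 * N))%:E)%E).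
  by apply: lee_wpmul2l => //; rewrite lee_fin mulr_ge0// ltW.
by rewrite -EFinM lee_fin mulrCA mulfV ?mulr1// gt_eqF// mulr_gt0.
Qed.

Lemma HAP_real p : measurable_fun setT p ->
  (energy (fun t => (p t)%:C%C) < +oo)%E -> HAP (fun t => (p t)%:C%C).
Proof.
move=> mp Ep; apply: HAP_limit; first exact: cmeasurable_real.
move=> e e0; have e4 : 0 < e / 4 by rewrite divr_gt0.
have [N [p' [N0 mp' p'N p'B pe]]] := L2_truncation mp Ep e4.
have [q [cq qN qB qe]] := L2_continuous_density mp' N0 p'N p'B e4.
have mq := continuous_measurable_fun cq.
exists (fun t => (q t)%:C%C); split; first exact: cmeasurable_real.
  apply: (HAP_unif_continuous mq _ qN qB); first by rewrite addr_ge0 ?ltW.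
  exact: compact_support_unif_continuous cq qN.
rewrite [X in energy X](_ : _ = (fun t => (p t - p' t)%:C%C) + (fun t => (p' t - q t)%:C%C)).
  have -> : e = 2 * (e / 4) + 2 * (e / 4) by field.
  by apply: energyD_le => //; apply: cmeasurable_real; exact: measurable_funB.
apply/funext => t; transitivity ((p t - q t)%:C%C); first by rewrite rmorphB.
by rewrite caddE -(rmorphD (real_complex R)) addrA subrK.
Qed.

Lemma HAP_L2 (f : R -> R[i]) : L2fun f -> HAP f.
Proof.
move=> /L2funE[[mr mi] Ef].
have mf : cmeasurable f by [].
have part (p : R -> R) : measurable_fun setT p -> (forall t, p t ^+ 2 <= csq (f t)) ->
    HAP (fun t => (p t)%:C%C).
  move=> mp pf; apply: HAP_real => //; apply: le_lt_trans Ef.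
  apply: energy_mono => //.
  by move=> t; rewrite csq_real.
have -> : f = (fun t => (complex.Re (f t))%:C%C) + 'i%C *: (fun t => (complex.Im (f t))%:C%C).
  apply/funext => t; rewrite caddE cscaleE; case: (f t) => a b.
  by apply/eqP; rewrite eq_complex/=; apply/andP; split; apply/eqP; ring.
apply: HAPD.
- exact: cmeasurable_real.
- by apply: cmeasurableZ; exact: cmeasurable_real.
- by apply: part => // t; rewrite lerDl sqr_ge0.
- apply: HAPZ; first exact: cmeasurable_real.
  by apply: part => // t; rewrite lerDr sqr_ge0.
Qed.

End Density.

(** * Counting points and the density bound *)

Section Counting.
Variables (R : realType) (g : R -> R[i]) (Lambda : set (R * R)).
Implicit Types (a b r d e rho : R) (lam : R * R).

Lemma span_span_others lam u :
  span [set tfshift g nu | nu in [set nu | Lambda nu /\ nu <> lam]] u ->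
  span_others g Lambda lam u.
Proof.
elim=> [|c _ y [nu [Lnu nulam] <-] _ [s [sL ->]]].
  by exists [::]; split => //; apply/funext => t; rewrite big_nil.
exists ((nu, c) :: s); split.
  by move=> p; rewrite inE => /predU1P[->//|/sL].
by apply/funext => t; rewrite big_cons.
Qed.

Lemma uniformly_minimal_energy d lam u : 0 < d ->
  (d%:E < L2dist (tfshift g lam) (span_others g Lambda lam))%E ->
  span [set tfshift g nu | nu in [set nu | Lambda nu /\ nu <> lam]] u ->
  ((d ^+ 2)%:E <= energy (tfshift g lam - u)%R)%E.
Proof.
move=> d0 dl /span_span_others su.
have : (d%:E < L2norm (fun t => (tfshift g lam t - u t)%R))%E.
  by apply: lt_le_trans dl _; apply: ereal_inf_lbound; exists u.
rewrite /L2norm -/(energy (tfshift g lam - u)).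
move: (energy_ge0 (tfshift g lam - u)); case: (energy _) => [x x0|_ _|//]; last exact: leey.
rewrite poweR_EFin !lte_fin lee_fin powR12_sqrt// => dx.
by rewrite -[leRHS]sqr_sqrtr// ler_pXn2r ?nnegrE ?sqrtr_ge0// ltW.
Qed.

Lemma size_separated_le d e r a b rho (l : seq (R * R)) :
  L2fun g -> 0 < d -> 0 <= e -> 0 <= r -> 0 <= rho ->
  (forall lam, Lambda lam ->
    (d%:E < L2dist (tfshift g lam) (span_others g Lambda lam))%E) ->
  (forall a b, exists2 u, span (box a b r) u &
    (energy (tfshift g (a, b) - u)%R <= (e ^+ 2)%:E)%E) ->
  uniq l -> (forall lam, lam \in l -> Lambda lam /\ Qsq (a, b) rho lam) ->
  (size l)%:R * (1 - e / d) <= (2 * rho + 2 * r + 2) ^+ 2.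
Proof.
move=> Lg d0 e0 r0 rho0 gd ge ul lL.
pose m0 := Num.floor (a - rho - r); pose n0 := Num.floor (b - rho - r).
(* The integers of an interval of length [2 * rho + 2 * r], numbered from the floor of its left end,
   have numbers below [D]; the two extra units pay for that floor and for the truncation. *)
pose D := (Num.truncn (2 * rho + 2 * r)).+2.
have DR : D%:R <= 2 * rho + 2 * r + 2.
  have : 0 <= 2 * rho + 2 * r by lra.
  by move=> /truncn_itv/andP[h _]; rewrite /D -addn2 natrD; lra.
pose ws : seq (R -> R[i]) :=
  [seq @box_atom R (m0 + i%:Z, n0 + j%:Z) | i <- iota 0 D, j <- iota 0 D].
have index_in x y (m : int) : `|x - y| <= rho -> `|m%:~R - x| <= r ->
    exists2 i, i \in iota 0 D & m = Num.floor (y - rho - r) + i%:Z.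
  rewrite !ler_norml => /andP[x1 x2] /andP[m1 m2].
  have := floor_itv (y - rho - r); rewrite intrD => /andP[f1 f2].
  have fm : (Num.floor (y - rho - r) <= m)%R by rewrite -(ler_int R); lra.
  exists `|m - Num.floor (y - rho - r)|%N.
    rewrite mem_iota leq0n add0n -(ltr_nat R) natr_absz.
    rewrite ger0_norm ?subr_ge0// intrB.
    rewrite /D -addn2 natrD /=; have := truncnS_gt (2 * rho + 2 * r).
    by rewrite -addn1 natrD; lra.
  by rewrite gez0_abs ?subr_ge0// [RHS]addrC subrK.
pose f (i : 'I_(size l)) := tfshift g (nth (0, 0) l i).
have lP (i : 'I_(size l)) : nth (0, 0) l i \in l by rewrite mem_nth.
have := @card_le_approx_dim_complex R 'I_(size l) f ws d e d0 e0.
rewrite card_ord size_allpairs !size_iota natrM => H.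
apply: le_trans (H _ _ _ _) _.
- by move=> i; exact: L2fun_tfshift.
- by move=> w /allpairsP[p [_ _ ->]]; exact: L2fun_box_atom.
- move=> i u su; apply: (@uniformly_minimal_energy d (nth (0, 0) l i)) => //.
    by apply: gd; case: (lL _ (lP i)).
  apply: span_mono su => _ [j /= ji <-]; exists (nth (0, 0) l j) => //.
  split; first by case: (lL _ (lP j)).
  by apply/eqP; rewrite nth_uniq.
- move=> i; have := lL _ (lP i); rewrite /f; case: (nth _ _ _) => x y [_ [/= xa yb]].
  have [u su ue] := ge x y; exists u => //; apply: span_mono su => _ [[m n] [/= mx ny] <-].
  have [k kD ->] := index_in _ _ _ xa mx; have [k' kD' ->] := index_in _ _ _ yb ny.
  by apply/allpairsP; exists (k, k').
- by rewrite -expr2 ler_pXn2r ?nnegrE//; lra.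
Qed.

(** An [esum] is a supremum over finite subsets, so infinite sets need no separate case. *)
Lemma npoints_le (S : set (R * R)) (B : R) :
  (forall l : seq (R * R), uniq l -> (forall lam, lam \in l -> Lambda lam /\ S lam) ->
    (size l)%:R <= B) ->
  (npoints Lambda S <= B%:E)%E.
Proof.
move=> lB; apply: ge_ereal_sup => _ [A [finA AS] <-].
rewrite fsbig_finite//= sumEFin lee_fin.
rewrite big_const_seq count_predT iter_addr_0; apply: lB; first exact: finmap.fset_uniq.
by move=> lam; rewrite in_fset_set// inE => /AS.
Qed.

End Counting.

Theorem theorem2 (R : realType) (g : R -> R[i]) (Lambda : set (R * R)) :
  L2fun g ->
  gabor_uniformly_minimal g Lambda ->
  (upper_density Lambda <= 1)%E.
Proof.
move=> Lg [d [d0 gd]]; apply/lee_addgt0Pr => eta eta0.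
(* The value that [1 - e / d] will take; its inverse spends half of the margin [eta]. *)
pose c := (1 + eta / 2)^-1.
have c0 : 0 < c by rewrite invr_gt0; lra.
have c1 : c < 1 by rewrite invf_lt1; lra.
pose e := d * (1 - c).
have e0 : 0 < e by rewrite mulr_gt0//; lra.
have edE : 1 - e / d = c by rewrite /e; field; rewrite gt_eqF.
have [r r0 gr] := HAP_L2 Lg (exprn_gt0 2 e0).
(* For [rho] above [M], the ratio [x = (r + 1) / rho] satisfies [x * (6 + 3 * eta) <= eta], which is
   equivalent to [(1 + 3 * x) * (1 + eta / 2) <= 1 + eta]. *)
pose M := (r + 1) * (6 + 3 * eta) / eta.
have M0 : 0 < M by rewrite divr_gt0// mulr_gt0//; lra.
apply: ge_ereal_inf.
exists (ereal_sup [set (ereal_sup [set npoints Lambda (Qsq ab rho) | ab in [set: R * R]]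
                   * ((2 * rho) ^+ 2)^-1%:E)%E | rho in [set rho | M < rho]]).
  by exists [set rho | M < rho] => //; exists M; split => //; exact: num_real.
apply: ge_ereal_sup => _ [rho /= Mrho <-].
have rho0 : 0 < rho by lra.
have rho2 : 0 < (2 * rho) ^+ 2 by rewrite exprn_gt0// mulr_gt0.
pose B := (2 * rho + 2 * r + 2) ^+ 2 / c.
have NB : (ereal_sup [set npoints Lambda (Qsq ab rho) | ab in [set: R * R]] <= B%:E)%E.
  apply: ge_ereal_sup => _ [[a b] _ <-]; apply: npoints_le => l ul lL.
  rewrite /B ler_pdivlMr// -edE.
  exact: (size_separated_le Lg d0 (ltW e0) r0 (ltW rho0) gd gr ul lL).
apply: (@le_trans _ _ (B%:E * ((2 * rho) ^+ 2)^-1%:E)%E).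
  by apply: lee_wpmul2r => //; rewrite lee_fin invr_ge0 ltW.
rewrite -EFinM -EFinD lee_fin ler_pdivrMr// /B /c invrK.
pose x := (r + 1) / rho.
have x0 : 0 <= x by rewrite divr_ge0 ?(ltW rho0)//; lra.
have xeta : x * (6 + 3 * eta) <= eta.
  move: Mrho; rewrite /M ltr_pdivrMr// => h.
  by rewrite /x mulrAC ler_pdivrMr// [eta * _]mulrC ltW.
have x1 : x <= 1.
  by rewrite -(@ler_pM2r _ (6 + 3 * eta)); lra.
have -> : 2 * rho + 2 * r + 2 = 2 * rho * (1 + x) by rewrite /x; field; rewrite gt_eqF.
rewrite exprMn -mulrA mulrC ler_pM2r//.
have h : (1 + x) ^+ 2 <= 1 + 3 * x by nra.
apply: (@le_trans _ _ ((1 + 3 * x) * (1 + eta / 2))).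
  by rewrite ler_pM2r//; lra.
by nra.
Qed.
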